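(* Let $N\ge 2$, let $K\subset\mathbb{R}^N$ be a convex body containing the origin in its interior, and let $G\subset\mathbb{R}^N$ be a $K$-dense body. Then $\partial G$ is of class $C^{1,1}$, that is, $\partial G$ is locally the graph of a $C^{1,1}$-smooth function.
   Context: A convex body is a compact convex set with nonempty interior; a body is a compact set with nonempty interior. $V$ denotes Lebesgue measure in $\mathbb{R}^N$. For $x\in\mathbb{R}^N$ and $r>0$ let $\delta_K(x,r)=V(G\cap(x+rK))/V(rK)$. A measurable set $G$ with $V(G)>0$ is called $K$-dense if there is a function $c:(0,\infty)\to(0,\infty)$ such that $\delta_K(x,r)=c(r)$ for every $(x,r)\in\partial G\times(0,\infty)$, where $\partial G$ is the topological boundary of $G$. A $K$-dense body is a body that is $K$-dense. A function is $C^{1,1}$-smooth if it is differentiable with locally Lipschitz continuous first derivatives. *)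

(* Defs.v *)
From HB Require Import structures.
From mathcomp Require Import all_boot all_order all_algebra.
From mathcomp Require Import all_classical all_reals all_analysis.

Set Implicit Arguments.
Unset Strict Implicit.
Unset Printing Implicit Defensive.

Import Order.TTheory GRing.Theory Num.Theory.
Import numFieldNormedType.Exports.

Local Open Scope classical_set_scope.
Local Open Scope ring_scope.

(* A K-dense set is not assumed bounded, so its measurability is that of      *)
(* Lebesgue: the N-fold product of the one-dimensional Lebesgue measure is    *)
(* built on the product (Borel) sigma-algebra of N.-tuple R, and is then      *)
(* completed through its outer measure.                                       *)

Section lebesgue_product.
Context {R : realType}.

Local Notation T := (measurableTypeR R).

Definition cons_pair n (p : T * n.-tuple T) : n.+1.-tuple T :=
  [the n.+1.-tuple T of p.1 :: p.2].

Lemma measurable_cons_pair n : measurable_fun [set: T * n.-tuple T] (@cons_pair n).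
Proof. by apply: (measurable_cons (f := fst) (g := snd)). Qed.

Definition lebesgue_cons n
    (mu : {sigma_finite_measure set (n.-tuple T) -> \bar R}) :
    set (n.+1.-tuple T) -> \bar R :=
  pushforward (@lebesgue_measure R \x mu)%E (@cons_pair n).

Section lebesgue_cons_measure.
Variables (n : nat) (mu : {sigma_finite_measure set (n.-tuple T) -> \bar R}).

Let lebesgue_cons0 : lebesgue_cons mu set0 = 0%E.
Proof. by rewrite /lebesgue_cons /pushforward preimage_set0 measure0. Qed.

Let lebesgue_cons_ge0 A : (0 <= lebesgue_cons mu A)%E.
Proof. by apply: integral_ge0 => // *. Qed.

Let preimage_cons_pair (A : set (n.+1.-tuple T)) :
  measurable A -> measurable (@cons_pair n @^-1` A).
Proof. by move=> mA; rewrite -[X in measurable X]setTI; exact: measurable_cons_pair. Qed.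

Let lebesgue_cons_additive : semi_sigma_additive (lebesgue_cons mu).
Proof.
move=> F mF tF mUF; rewrite /lebesgue_cons /pushforward preimage_bigcup.
apply: measure_semi_sigma_additive.
- by move=> k; exact: preimage_cons_pair.
- apply/trivIsetP => /= i j _ _ ij; rewrite -preimage_setI.
  by move/trivIsetP : tF => /(_ _ _ _ _ ij) ->//; rewrite preimage_set0.
- by rewrite -preimage_bigcup; exact: preimage_cons_pair.
Qed.

HB.instance Definition _ := isMeasure.Build _ _ _ (lebesgue_cons mu)
  lebesgue_cons0 lebesgue_cons_ge0 lebesgue_cons_additive.

Let lebesgue_cons_sigma_finite : sigma_finite setT (lebesgue_cons mu).
Proof.
have /sigma_finiteP[F [FT ndF Foo]] := sigma_finiteT (@lebesgue_measure R).
have /sigma_finiteP[H [HT ndH Hoo]] := sigma_finiteT mu.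
pose g (t : n.+1.-tuple T) : T * n.-tuple T :=
  (thead t, [tuple of behead t]).
have mg : measurable_fun setT g.
  by apply/measurable_fun_pair; [exact: measurable_tnth|exact: measurable_behead].
have gK : cancel (@cons_pair n) g.
  by move=> [x t]; congr pair; apply/val_inj.
exists (fun k => g @^-1` (F k `*` H k)).
  rewrite -preimage_bigcup (_ : \bigcup_k _ = setT) ?preimage_setT//.
  apply/seteqP; split => // -[x t] _.
  have [i _ Fx] : (\bigcup_k F k) x by rewrite -FT.
  have [j _ Ht] : (\bigcup_k H k) t by rewrite -HT.
  exists (maxn i j) => //; split => /=.
    by move: x Fx; exact/subsetPset/ndF/leq_maxl.
  by move: t Ht; exact/subsetPset/ndH/leq_maxr.
move=> k; have [mF FooE] := Foo k; have [mH HooE] := Hoo k; split.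
  by rewrite -[X in measurable X]setTI; apply: mg => //; exact: measurableX.
rewrite /lebesgue_cons /pushforward -comp_preimage.
rewrite (_ : g \o _ = id); last by apply/funext => p /=; exact: gK.
by rewrite preimage_id product_measure1E// lte_mul_pinfty// ge0_fin_numE.
Qed.

HB.instance Definition _ := Measure_isSigmaFinite.Build _ _ _ (lebesgue_cons mu)
  lebesgue_cons_sigma_finite.

End lebesgue_cons_measure.

Fixpoint lebesgue_tuple n : {sigma_finite_measure set (n.-tuple T) -> \bar R} :=
  match n with
  | 0 => \d_([tuple] : 0.-tuple T)
  | m.+1 => lebesgue_cons (lebesgue_tuple m)
  end.

Lemma lebesgue_tuple_box n (A : 'I_n -> set T) :
  (forall i, measurable (A i)) ->
  lebesgue_tuple n [set t | forall i, A i (tnth t i)] =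
    (\prod_(i < n) lebesgue_measure (A i))%E.
Proof.
elim: n A => [|n IH] A mA /=.
  rewrite big_ord0 diracE mem_set//= => i; by case: i.
rewrite /lebesgue_cons /pushforward big_ord_recl -IH; last by move=> i; exact: mA.
rewrite -product_measure1E//=; last first.
  rewrite (_ : mkset _ = \bigcap_(i in [set: 'I_n]) ((@tnth n T)^~ i @^-1` A (lift ord0 i))).
    apply: fin_bigcap_measurable; first exact: finite_finset.
    by move=> i _; rewrite -[X in measurable X]setTI; exact: measurable_tnth.
  by apply/seteqP; split => t /= tA i; [move=> _; exact: tA|exact: tA].
congr (_ _); apply/seteqP; split => -[x t] /=.
- by move=> xt; split; [exact: (xt ord0)|move=> i; move: (xt (lift ord0 i)); rewrite tnthS].
- move=> [x0 ti] i; case: (unliftP ord0 i) => [j ->|-> //].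
  by rewrite tnthS; exact: ti.
Qed.

End lebesgue_product.

Section lebesgue_rV.
Context {R : realType} {N : nat}.
Implicit Types A : set 'rV[R]_N.

Definition tuple_set A : set (N.-tuple (measurableTypeR R)) :=
  [set t | A (\row_i tnth t i)].

(* Agrees with lebesgue_tuple on Borel sets: see measurable_mu_extE. *)
Definition lebesgue_rV A : \bar R := mu_ext (lebesgue_tuple N) (tuple_set A).

Definition lebesgue_measurable_rV A : Prop :=
  caratheodory_measurable (mu_ext (lebesgue_tuple N)) (tuple_set A).

End lebesgue_rV.

Section bodies.
Context {R : realType} {N : nat}.
Implicit Types (A G K : set 'rV[R]_N) (x : 'rV[R]_N) (r : R).

(* The topology of 'rV[R]_N comes from the sup norm, hence is the usual one.  *)
Definition boundary A : set 'rV[R]_N := closure A `\` A°.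

Definition body A : Prop := compact A /\ A° !=set0.

Definition convex_body A : Prop :=
  body A /\ convex_set (A : set (convex_lmodType 'rV[R]_N)).

Definition translate_scale x r K : set 'rV[R]_N := [set x + r *: k | k in K].

(* When K is a body both volumes are finite, so [fine] loses nothing.         *)
Definition density G K x r : R :=
  fine (lebesgue_rV (G `&` translate_scale x r K)) /
  fine (lebesgue_rV (translate_scale 0 r K)).

Definition K_dense K G : Prop :=
  [/\ lebesgue_measurable_rV G, (0 < lebesgue_rV G)%E &
    exists c : R -> R, (forall r, 0 < r -> 0 < c r) /\
      forall x r, boundary G x -> 0 < r -> density G K x r = c r].

Definition K_dense_body K G : Prop := body G /\ K_dense K G.

End bodies.

Section smoothness.
Context {R : realType}.

Definition locally_lipschitz n (W : set 'rV[R]_n) (g : 'rV[R]_n -> R^o) : Prop :=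
  forall y, W y -> exists2 U, nbhs y U & [lipschitz g z | z in U].

(* The first derivatives are the partial derivatives along the standard basis. *)
Definition C11_on n (W : set 'rV[R]_n) (f : 'rV[R]_n -> R^o) : Prop :=
  (forall y, W y -> differentiable f y) /\
  forall i : 'I_n, locally_lipschitz W (fun y => 'D_(delta_mx 0 i) f y).

(* The rows of B together with nu form an orthonormal basis of R^N.           *)
Definition orthonormal_frame N (B : 'M[R]_(N.-1, N)) (nu : 'rV[R]_N) : Prop :=
  [/\ B *m B^T = 1%:M, B *m nu^T = 0 & nu *m nu^T = 1%:M].

Definition graph_on N (B : 'M[R]_(N.-1, N)) (nu : 'rV[R]_N)
    (W : set 'rV[R]_N.-1) (f : 'rV[R]_N.-1 -> R) : set 'rV[R]_N :=
  [set y *m B + f y *: nu | y in W].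

Definition locally_C11_graph N (S : set 'rV[R]_N) : Prop :=
  forall p, S p ->
    exists (B : 'M[R]_(N.-1, N)) (nu : 'rV[R]_N) (U : set 'rV[R]_N)
           (W : set 'rV[R]_N.-1) (f : 'rV[R]_N.-1 -> R^o),
      [/\ orthonormal_frame B nu, open U /\ U p, open W, C11_on W f &
          S `&` U = graph_on B nu W f].

End smoothness.

(* Main.v *)
(* Once [r] is so large that [x + r K] covers [G] the density detects exactly   *)
(* this, so the smallest covering radius is the same for all [x] in the         *)
(* boundary of [G]. If a point [y] of the convex hull were missing from [G], a  *)
(* boundary point [x] on a segment from an interior point of [G] to [y] would   *)
(* be interior to every [g - r K] with [r] covering, and would allow a smaller  *)
(* radius; hence [G] is convex.                                                 *)
(*                                                                            *)
(* Let [x], [m + v], [m - v] be boundary points with [m = x + s nu] and [nu]    *)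
(* pointing inward. For small [r] the volume of [G] in [y + r K] takes the same *)
(* value at these three points and is larger by at least [kappa s] at [m]. The  *)
(* sum over equally spaced radii of the indicator functions of [r K] is, at     *)
(* the scale [|v|], a Lipschitz function, while the symmetric difference of [G] *)
(* and [G + v] has volume O([|v|]); so the sum over [1 / |v|] radii of the      *)
(* second differences of the volume is O([|v|]). Therefore [s] is O([|v|^2]):   *)
(* the convex function whose graph is the boundary is also semiconcave, and     *)
(* such functions are of class C^{1,1}.                                        *)
Require Import Defs.
From HB Require Import structures.
From mathcomp Require Import all_boot all_order all_algebra.
From mathcomp Require Import all_classical all_reals all_analysis.
From mathcomp Require Import ring lra.

Set Implicit Arguments.
Unset Strict Implicit.
Unset Printing Implicit Defensive.

Import Order.TTheory GRing.Theory Num.Theory.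
Import numFieldNormedType.Exports.
Local Open Scope classical_set_scope.
Local Open Scope ring_scope.

(** * Translation invariance of Lebesgue measure *)

(** Along the boundary of [G] the volume of [G] in [x + r K] is a function [a r] of the radius
    alone, and this is exploited at two scales.

    Large radii give convexity. Since [a > 0], [G] has positive volume near each of its points, so
    [x + r K] covers [G] exactly when [a r = vol G]: all boundary points have the same covering
    radii. A point of the convex hull missing from [G] would let every covering radius shrink by one
    fixed factor, which is absurd at their infimum ([segment_closed_body]).

    Small radii give regularity. Locally the boundary is the graph of a convex, hence Lipschitz,
    function ([convex_local_graph], [convex_bounded_lipschitz]). The graph points over [y], [y + h],
    [y - h] have the form [x], [m + v], [m - v], where [m = x + s nu] and [2 s] is the second
    difference of the function. Moving the centre from [x] to [m] raises the volume by at least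
    [kap s] ([vol_translate_scale_gain]), so the volume has second difference at least [2 kap s] at
    [m], for every radius in [[r0, 2 r0]]. Add this over about [1 / |v|] radii with step
    proportional to [|v|]: the sum telescopes and is at most the volume of the symmetric difference
    of [G] and [G + v], which is O(|v|) ([vol_second_difference_sum], [vol_layer_le]). Hence [s] is
    O(|v|^2) ([boundary_second_difference]). A convex function with second differences O(|h|^2) is
    differentiable with Lipschitz gradient ([C11_convex_semiconcave]). *)

Section lebesgue_translation.
Context {R : realType}.
Local Notation T := (measurableTypeR R).

Lemma lebesgue_measure_translation (a : R) (A : set T) : measurable A ->
  lebesgue_measure ((fun x : T => x + a : T) @^-1` A) = lebesgue_measure A.
Proof.
have mf : measurable_fun [set: T] (fun x : T => x + a : T).
  by apply: measurable_realfun.measurable_funD => //; exact: measurable_id.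
pose mu : {measure set T -> \bar R} :=
  pushforward (@lebesgue_measure R) (fun x : T => x + a : T).
move=> mA; rewrite -[LHS]/(mu mf A); apply/esym.
apply: lebesgue_measure_unique => // _ [[x y] xy <-] /=.
rewrite /mu /pushforward /=.
rewrite (_ : _ @^-1` _ = `](x - a), (y - a)]%classic); last first.
  by apply/seteqP; split => z /=; rewrite !in_itv /= ltrBlDr lerBrDr.
rewrite !lebesgue_measure_itv /= !lte_fin ltrD2r; case: ifPn => // _.
by rewrite !EFinD; congr (_%:E); ring.
Qed.

Definition tuple_translate n (v : 'I_n -> R) (t : n.-tuple T) : n.-tuple T :=
  [tuple (tnth t i + v i : T) | i < n].

Lemma measurable_tuple_translate n (v : 'I_n -> R) :
  measurable_fun [set: n.-tuple T] (tuple_translate v).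
Proof.
apply/measurable_fun_tnthP => i.
rewrite (_ : _ \o _ = fun t : n.-tuple T => (tnth t i : R) + v i); last first.
  by apply/funext => t /=; rewrite tnth_mktuple.
apply: measurable_realfun.measurable_funD => //; exact: measurable_tnth.
Qed.

(** Induction on the dimension: the pushforward of the product measure under the shift agrees with
    it on rectangles, so uniqueness of product measures applies. *)
Lemma lebesgue_tuple_translation n (v : 'I_n -> R) (A : set (n.-tuple T)) :
  measurable A ->
  lebesgue_tuple n (tuple_translate v @^-1` A) = lebesgue_tuple n A.
Proof.
elim: n v A => [|n IH] v A mA.
  congr (lebesgue_tuple 0 _); apply/seteqP; split => t /=;
  by rewrite (tuple0 t) (tuple0 (tuple_translate _ _)).
pose v' (i : 'I_n) := v (lift ord0 i).
pose h (p : T * n.-tuple T) : T * n.-tuple T :=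
  (p.1 + v ord0 : T, tuple_translate v' p.2).
have mh1 : measurable_fun [set: T] (fun x : T => x + v ord0 : T).
  by apply: measurable_realfun.measurable_funD => //; exact: measurable_id.
have mh : measurable_fun [set: T * n.-tuple T] h.
  apply/measurable_fun_pair.
    exact: (measurableT_comp mh1).
  by apply: measurableT_comp => //; exact: measurable_tuple_translate.
pose m' : {measure set (T * n.-tuple T) -> \bar R} :=
  pushforward (@lebesgue_measure R \x lebesgue_tuple n)%E h.
have mB (B : set (n.+1.-tuple T)) : measurable B -> measurable (@cons_pair R n @^-1` B).
  by move=> ?; rewrite -[X in measurable X]setTI; exact: measurable_cons_pair.
rewrite /= /lebesgue_cons /pushforward.
rewrite [RHS](@product_measure_unique _ _ _ _ _ _ _ (m' mh)); last exact: mB.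
  rewrite /m' /pushforward; congr (_ _).
  apply/seteqP; split => -[x t] /=.
    congr (A _); apply/eq_from_tnth => i; rewrite tnth_mktuple.
    case: (unliftP ord0 i) => [j ->|->].
      by rewrite !tnthS tnth_mktuple.
    by rewrite !tnth0.
  congr (A _); apply/eq_from_tnth => i; rewrite tnth_mktuple.
  case: (unliftP ord0 i) => [j ->|->].
    by rewrite !tnthS tnth_mktuple.
  by rewrite !tnth0.
move=> X Y mX mY; rewrite /m' /pushforward.
have lX : lebesgue_measure X = lebesgue_measure ((fun x : T => x + v ord0 : T) @^-1` X).
  by rewrite lebesgue_measure_translation.
rewrite [X in (X * _)%E]lX -(IH v' Y mY) -product_measure1E //.
- by rewrite -[X in measurable X]setTI; exact: mh1.
- by rewrite -[X in measurable X]setTI; exact: measurable_tuple_translate.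
Qed.

End lebesgue_translation.

(** * Volume of Borel sets *)

Section rV_norm.
Context {R : realType} {N : nat}.
Implicit Types (x : 'rV[R]_N) (e : R).

Lemma rV_norm_leP x e : 0 <= e -> `|x| <= e <-> forall i, `|x 0 i| <= e.
Proof.
move=> e0; rewrite [X in X <= _](mx_normrE x); split.
  by move=> /bigmax_leP[_ h] i; exact: (h (0, i)).
by move=> h; apply/bigmax_leP; split => // -[i j] _; rewrite ord1; exact: h.
Qed.

Lemma rV_norm_ltP x e : 0 < e -> `|x| < e <-> forall i, `|x 0 i| < e.
Proof.
move=> e0; rewrite [X in X < _](mx_normrE x); split.
  by move=> /bigmax_ltP[_ h] i; exact: (h (0, i)).
by move=> h; apply/bigmax_ltP; split => // -[i j] _; rewrite ord1; exact: h.
Qed.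

Lemma coord_le_norm x i : `|x 0 i| <= `|x|.
Proof. by move: i; apply/rV_norm_leP. Qed.

(* [normrZ] with the norm of ['rV[R]_N] itself, syntactically different from    *)
(* the one inherited from its normed module structure.                        *)
Lemma rV_normZ (c : R) x : `|c *: x| = `|c| * `|x|.
Proof. exact: normrZ. Qed.

End rV_norm.

Section volume.
Context {R : realType} {N : nat}.
Implicit Types (A B E : set 'rV[R]_N) (v x : 'rV[R]_N).
Local Notation T := (measurableTypeR R).

(** Stated on tuples, where the product sigma-algebra lives; on such sets the outer measure
    [lebesgue_rV] is the product measure itself ([lebesgue_rVE]). *)
Definition borel A : Prop := measurable (tuple_set A).

(** [fine] sends infinite measure to 0, which is why monotonicity and additivity are stated for
    [bounded_borel] sets. *)
Definition vol A : R := fine (lebesgue_rV A).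

Definition translate v A : set 'rV[R]_N := [set x | A (x - v)].

Definition bounded_by (M : R) A : Prop := forall x, A x -> `|x| <= M.

Definition bounded_borel A : Prop := borel A /\ exists M, bounded_by M A.

Lemma borelC A : borel A -> borel (~` A).
Proof. exact: measurableC. Qed.

Lemma borelI A B : borel A -> borel B -> borel (A `&` B).
Proof. exact: measurableI. Qed.

Lemma borelD A B : borel A -> borel B -> borel (A `\` B).
Proof. exact: measurableD. Qed.

Lemma borel_box (a b : 'I_N -> R) : borel [set x | forall i, a i < x 0 i < b i].
Proof.
rewrite /borel.
have -> : tuple_set [set x | forall i, a i < x 0 i < b i] =
   \bigcap_(i in [set: 'I_N]) ((fun t : N.-tuple T => tnth t i) @^-1` `]a i, b i[%classic).
  apply/seteqP; split => t /=.
    by move=> h i _ /=; rewrite in_itv /=; move: (h i); rewrite mxE.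
  by move=> h i; move: (h i I) => /=; rewrite in_itv /= mxE.
apply: fin_bigcap_measurable; first exact: finite_finset.
move=> i _; rewrite -[X in measurable X]setTI; exact: measurable_tnth.
Qed.

(** The open boxes with rational corners contained in [A] are countably many and cover it. *)
Lemma borel_open A : open A -> borel A.
Proof.
move=> oA.
pose box (q : 'rV[rat]_N * 'rV[rat]_N) : set 'rV[R]_N :=
  [set x | forall i, ratr (q.1 0 i) < x 0 i < ratr (q.2 0 i)].
pose F q := if `[< box q `<=` A >] then box q else set0.
have -> : A = \bigcup_q F q.
  apply/seteqP; split => x; last first.
    by move=> [q _]; rewrite /F; case: asboolP => // qA /qA.
  move=> Ax; have /nbhs_ballP[e /= e0 eA] : nbhs x A by apply: open_nbhs_nbhs.
  have /choice[a aP] : forall i, exists q : rat, x 0 i - e < ratr q < x 0 i.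
    move=> i; have [|q] := @rat_in_itvoo R (x 0 i - e) (x 0 i); first by lra.
    by rewrite in_itv => qP; exists q.
  have /choice[b bP] : forall i, exists q : rat, x 0 i < ratr q < x 0 i + e.
    move=> i; have [|q] := @rat_in_itvoo R (x 0 i) (x 0 i + e); first by lra.
    by rewrite in_itv => qP; exists q.
  exists (\row_i a i, \row_i b i) => //; rewrite /F; case: asboolP.
    by move=> _ i /=; rewrite !mxE; have := aP i; have := bP i; lra.
  case=> y ybox; apply: eA; rewrite -ball_normE /=; apply/rV_norm_ltP => // i.
  have := ybox i; rewrite /= !mxE; have := aP i; have := bP i.
  by rewrite ltr_norml; lra.
rewrite /borel.
have -> : tuple_set (\bigcup_q F q) = \bigcup_q tuple_set (F q) by [].
apply: countable_bigcupT_measurable; first exact: countableP.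
move=> q; rewrite /F; case: asboolP => _.
  exact: borel_box.
exact: measurable0.
Qed.

Lemma borel_closed A : closed A -> borel A.
Proof. by move=> cA; rewrite -[A]setCK; apply: borelC; apply: borel_open; exact: closed_openC. Qed.

Lemma tuple_set_translate v A :
  tuple_set (translate v A) = tuple_translate (fun i => - v 0 i) @^-1` tuple_set A.
Proof.
apply/funext => t /=; rewrite /translate /tuple_set /=; congr A.
by apply/rowP => i; rewrite !mxE tnth_mktuple.
Qed.

Lemma borel_translate v A : borel A -> borel (translate v A).
Proof.
rewrite /borel tuple_set_translate => mA.
by rewrite -[X in measurable X]setTI; exact: measurable_tuple_translate.
Qed.

Lemma bounded_borelI A B : bounded_borel A -> borel B -> bounded_borel (A `&` B).
Proof.
move=> [bA [M AM]] bB; split; first exact: borelI.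
by exists M => x [/AM].
Qed.

Lemma bounded_borelD A B : bounded_borel A -> borel B -> bounded_borel (A `\` B).
Proof. by move=> bA bB; apply: bounded_borelI => //; exact: borelC. Qed.

Lemma bounded_borel_translate v A : bounded_borel A -> bounded_borel (translate v A).
Proof.
move=> [bA [M AM]]; split; first exact: borel_translate.
by exists (M + `|v|) => x /AM h; have := ler_normD (x - v) v; rewrite subrK; lra.
Qed.

Lemma borel_ball x e : borel (ball x e).
Proof. by apply: borel_open; exact: ball_open. Qed.

Lemma lebesgue_rVE A : borel A -> lebesgue_rV A = lebesgue_tuple N (tuple_set A).
Proof. by move=> bA; rewrite /lebesgue_rV measurable_mu_extE. Qed.

Lemma lebesgue_rV_translate v A : borel A ->
  lebesgue_rV (translate v A) = lebesgue_rV A.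
Proof.
move=> bA; rewrite !lebesgue_rVE//; last exact: borel_translate.
by rewrite tuple_set_translate lebesgue_tuple_translation.
Qed.

Lemma vol_translate v A : borel A -> vol (translate v A) = vol A.
Proof. by move=> bA; rewrite /vol lebesgue_rV_translate. Qed.

Lemma lebesgue_rV_box (a b : 'I_N -> R) : (forall i, a i < b i) ->
  lebesgue_rV [set x | forall i, a i < x 0 i < b i] = (\prod_i (b i - a i))%:E.
Proof.
move=> ab; rewrite lebesgue_rVE; last exact: borel_box.
have -> : tuple_set [set x | forall i, a i < x 0 i < b i] =
    [set t : N.-tuple T | forall i, (`]a i, b i[%classic : set T) (tnth t i)].
  by apply/funext => t; apply/propext; split=> h i; move: (h i); rewrite /= in_itv /= mxE.
rewrite (@lebesgue_tuple_box R N (fun i => `]a i, b i[%classic)); last by move=> i; exact: measurable_itv.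
rewrite -prodEFin; apply: eq_bigr => i _.
by rewrite lebesgue_measure_itv /= lte_fin ab.
Qed.

Lemma le_lebesgue_rV A B : borel A -> borel B -> A `<=` B ->
  (lebesgue_rV A <= lebesgue_rV B)%E.
Proof.
move=> bA bB AB; rewrite !lebesgue_rVE//; apply: le_measure; rewrite ?inE//.
by move=> t; exact: AB.
Qed.

Lemma lebesgue_rV_fin A : bounded_borel A -> lebesgue_rV A \is a fin_num.
Proof.
move=> [bA [M AM]]; rewrite ge0_fin_numE; last by rewrite lebesgue_rVE.
have [M0|M0] := ltP M 0.
  have -> : A = set0.
    by apply/seteqP; split => // x /AM h; have := normr_ge0 x; lra.
  have -> : lebesgue_rV (set0 : set 'rV[R]_N) = 0%E; last by rewrite ltry.
  by rewrite lebesgue_rVE; [exact: measure0|exact: measurable0].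
apply: (@le_lt_trans _ _ (lebesgue_rV [set x : 'rV_N | forall i, - (M + 1) < x 0 i < M + 1])).
  apply: le_lebesgue_rV => //; first exact: (borel_box (fun=> - (M+1)) (fun=> M + 1)).
  by move=> x /AM xM i /=; have := coord_le_norm x i; rewrite ler_norml; lra.
rewrite (@lebesgue_rV_box (fun=> - (M+1)) (fun=> M + 1)) ?ltry//.
by move=> _; lra.
Qed.

Lemma vol0 : vol (set0 : set 'rV[R]_N) = 0.
Proof. by rewrite /vol lebesgue_rVE; [rewrite (measure0 _)|exact: measurable0]. Qed.

Lemma vol_ge0 A : borel A -> 0 <= vol A.
Proof. by move=> bA; rewrite fine_ge0// lebesgue_rVE. Qed.

Lemma le_vol A B : borel A -> bounded_borel B -> A `<=` B -> vol A <= vol B.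
Proof.
move=> bA bB AB; apply: fine_le; last exact: (le_lebesgue_rV bA bB.1 AB).
  apply: lebesgue_rV_fin; split => //; case: bB => _ [M BM].
  by exists M => x /AB/BM.
exact: lebesgue_rV_fin.
Qed.

Lemma vol_splitI A B : bounded_borel A -> borel B ->
  vol A = vol (A `&` B) + vol (A `\` B).
Proof.
move=> bA bB.
have bAI := bounded_borelI bA bB; have bAD := bounded_borelD bA bB.
rewrite /vol -fineD; [|exact: lebesgue_rV_fin..].
rewrite !lebesgue_rVE; [|exact: (proj1 bAD)|exact: (proj1 bAI)|exact: (proj1 bA)].
congr fine; rewrite [RHS]addeC; apply: (measureDI _ bA.1 bB).
Qed.

Lemma vol_gt0 A x : bounded_borel A -> nbhs x A -> 0 < vol A.
Proof.
move=> bA /nbhs_ballP[e /= e0 xA].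
pose B := [set y : 'rV[R]_N | forall i, x 0 i - e < y 0 i < x 0 i + e].
have bB : borel B by exact: (borel_box (fun i => x 0 i - e) (fun i => x 0 i + e)).
have BA : B `<=` A.
  move=> y yB; apply: xA; rewrite -ball_normE /=; apply/rV_norm_ltP => // i.
  by rewrite !mxE ltr_norml; have := yB i; lra.
apply: lt_le_trans (le_vol bB bA BA).
rewrite /vol (@lebesgue_rV_box (fun i => x 0 i - e) (fun i => x 0 i + e)) /=.
  by apply: prodr_gt0 => i _; lra.
by move=> i; lra.
Qed.

Lemma vol_packing (n : nat) (F : nat -> set 'rV[R]_N) B :
  (forall j, (j < n)%N -> borel (F j) /\ F j `<=` B) ->
  (forall i j, (i < j < n)%N -> F i `&` F j = set0) ->
  bounded_borel B -> \sum_(j < n) vol (F j) <= vol B.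
Proof.
elim: n B => [|n IH] B FB Fd bB; first by rewrite big_ord0; exact: vol_ge0 bB.1.
have [bF FnB] := FB n (ltnSn n).
rewrite big_ord_recr /= (vol_splitI bB bF) addrC lerD//.
  by rewrite le_eqVlt; apply/orP; left; apply/eqP; congr vol; rewrite setIC setIidl.
apply: IH.
- move=> j jn; have [bFj FjB] := FB j (ltnW jn); split => // x Fx.
  by split; [exact: FjB|move=> Fn; have : (F j `&` F n) x by []; rewrite Fd// jn leqnn].
- by move=> i j /andP[ij jn]; rewrite Fd// ij ltnW.
- exact: bounded_borelD.
Qed.

Lemma vol_cover (n : nat) (F : nat -> set 'rV[R]_N) B :
  (forall j, (j < n)%N -> bounded_borel (F j)) ->
  bounded_borel B -> (forall x, B x -> exists2 j, (j < n)%N & F j x) ->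
  vol B <= \sum_(j < n) vol (F j).
Proof.
elim: n B => [|n IH] B bF bB BF.
  rewrite big_ord0 (_ : B = set0); last by apply/seteqP; split => // x /BF[].
  by rewrite vol0.
have bFn := bF n (ltnSn n).
rewrite big_ord_recr /= (vol_splitI bB bFn.1) addrC lerD//.
  apply: le_vol; [exact: (bounded_borelI bB bFn.1).1|by []|by move=> x []].
apply: IH; first by move=> j jn; exact/bF/ltnW.
- exact: bounded_borelD bFn.1.
- move=> x [/BF[j]]; rewrite ltnS leq_eqVlt => /orP[/eqP->//|jn Fj _].
  by exists j.
Qed.

End volume.

(** * Convexity of dense bodies *)

Section convexity.
Context {R : realType} {N : nat}.
Implicit Types (A G K : set 'rV[R]_N) (x y z v w : 'rV[R]_N).

Definition ball_sub A z (e : R) : Prop := forall w, `|w - z| < e -> A w.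

Definition segment_closed A : Prop := forall x y (a b : R),
  A x -> A y -> 0 <= a -> 0 <= b -> a + b = 1 -> A (a *: x + b *: y).

Lemma convex_segment_closed A :
  convex_set (A : set (convex_lmodType 'rV[R]_N)) -> segment_closed A.
Proof.
move=> cA x y a b Ax Ay a0 b0 ab.
have a1 : 0 <= a <= 1 by lra.
have := cA x y (Itv01 (proj1 (andP a1)) (proj2 (andP a1))).
rewrite !inE => /(_ Ax Ay); rewrite /conv /=.
by rewrite (_ : b = 1 - a)//; lra.
Qed.

Lemma segment_closed_norm_lt z (r : R) : segment_closed [set x | `|x - z| < r].
Proof.
move=> x y a b /= xr yr a0 b0 ab.
rewrite (_ : _ - z = a *: (x - z) + b *: (y - z)); last first.
  by apply/rowP => i; rewrite !mxE (_ : b = 1 - a); [ring|lra].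
apply: le_lt_trans (ler_normD _ _) _; rewrite !rV_normZ !ger0_norm//.
have [a_eq0|a_neq0] := eqVneq a 0.
  by rewrite a_eq0 mul0r add0r (_ : b = 1) ?mul1r//; lra.
have a_gt0 : 0 < a by rewrite lt_neqAle eq_sym a_neq0.
have h1 : a * `|x - z| < a * r by rewrite ltr_pM2l.
have h2 : b * `|y - z| <= b * r by apply: ler_wpM2l => //; exact: ltW.
have -> : r = a * r + b * r by rewrite -mulrDl ab mul1r.
by lra.
Qed.

Lemma interior_ball_sub A z : A° z <-> exists2 e, 0 < e & ball_sub A z e.
Proof.
split.
  move=> /nbhs_ballP[e /= e0 h]; exists e => // w wz; apply: h.
  by rewrite -ball_normE /= distrC.
move=> [e e0 h]; apply/nbhs_ballP; exists e => // w.
by rewrite -ball_normE /= distrC => /h.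
Qed.

Lemma closedP A : closed A <-> forall x,
  (forall e, 0 < e -> exists2 y, A y & `|y - x| < e) -> A x.
Proof.
split=> [cA x h|h x clx].
  apply: cA => B /nbhs_ballP[e /= e0 eB].
  have [y Ay yx] := h _ e0; exists y; split => //; apply: eB.
  by rewrite -ball_normE /= distrC.
apply: h => e e0; have [y [Ay]] := clx _ (nbhsx_ballx x e e0).
by rewrite -ball_normE /= distrC; exists y.
Qed.

Lemma closed_boundary A x : closed A -> boundary A x <-> A x /\ ~ A° x.
Proof. by move=> cA; rewrite /boundary -(closure_id A).1. Qed.

(** The homothety with centre [x] and ratio [a] maps the ball about [z] onto the new one; [u] is the
    preimage of [w]. *)
Lemma segment_closed_ball_sub A z e x (a b : R) : segment_closed A ->
  ball_sub A z e -> A x -> 0 < a -> 0 <= b -> a + b = 1 ->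
  ball_sub A (a *: z + b *: x) (a * e).
Proof.
move=> cA zA Ax a0 b0 ab w wP.
pose u := z + a^-1 *: (w - (a *: z + b *: x)).
have Au : A u.
  apply: zA; rewrite /u addrAC subrr add0r rV_normZ gtr0_norm ?invr_gt0//.
  by rewrite mulrC ltr_pdivrMr// mulrC.
have -> : w = a *: u + b *: x; last exact: cA (ltW a0) b0 ab.
by apply/rowP => i; rewrite !mxE; field; lra.
Qed.

(** The parameter is the supremum of those whose point lies in [A]; beyond an interior point it
    could be increased. *)
Lemma boundary_segment A z y : closed A -> A z -> ~ A y ->
  exists2 t : R, 0 <= t <= 1 & boundary A ((1 - t) *: z + t *: y).
Proof.
move=> cA Az nAy.
have seg t : (1 - t) *: z + t *: y = z + t *: (y - z).
  by apply/rowP => i; rewrite !mxE; ring.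
pose E := [set t : R | 0 <= t <= 1 /\ A (z + t *: (y - z))].
have E0 : E 0 by split; [lra|rewrite scale0r addr0].
have E1 : ubound E 1 by move=> t [/andP[]].
have supE : has_sup E by split; [exists 0|exists 1].
pose s := sup E.
have s0 : 0 <= s by apply: ub_le_sup => //; exists 1.
have s1 : s <= 1 by apply: ge_sup => //; exists 0.
have near d : 0 < d -> exists2 d', 0 < d' &
    forall t, `|t - s| < d' -> `|z + t *: (y - z) - (z + s *: (y - z))| < d.
  move=> d0; exists (d / (`|y - z| + 1)).
    by rewrite divr_gt0// ltr_wpDl.
  move=> t; rewrite ltr_pdivlMr ?ltr_wpDl// => h.
  have -> : z + t *: (y - z) - (z + s *: (y - z)) = (t - s) *: (y - z).
    by apply/rowP => i; rewrite !mxE; ring.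
  by rewrite rV_normZ (le_lt_trans _ h)// ler_wpM2l//; lra.
have As : A (z + s *: (y - z)).
  apply: (closedP _).1 => // e /near[d d0 dP].
  have [t [t01 At] st] := sup_adherent d0 supE.
  exists (z + t *: (y - z)) => //; apply: dP.
  have ts : t <= s by apply: ub_le_sup; [exists 1|split].
  by rewrite -/s in st; rewrite ltr_norml; lra.
exists s; first by rewrite s0.
rewrite seg; apply/closed_boundary => //; split => // /interior_ball_sub[e e0 eA].
have s_lt1 : s < 1.
  rewrite lt_neqAle s1 andbT; apply/eqP => se; apply: nAy.
  by move: As; rewrite se scale1r addrC subrK.
have [d d0 dP] := near _ e0.
pose t := Num.min 1 (s + d / 2).
have ts : s < t by rewrite lt_min s_lt1; lra.
have td : t <= s + d / 2 by rewrite ge_min lexx orbT.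
have t1 : t <= 1 by rewrite ge_min lexx.
suff : t <= s by lra.
apply: ub_le_sup; first by exists 1.
split; first by lra.
by apply/eA/dP; rewrite ltr_norml; lra.
Qed.

Lemma exists_unit_vector : (0 < N)%N -> exists u : 'rV[R]_N, `|u| = 1.
Proof.
move=> N0; pose u : 'rV[R]_N := const_mx 1.
have u0 : `|u| != 0.
  rewrite normr_eq0; apply/eqP => /rowP/(_ (Ordinal N0)).
  by rewrite !mxE => /eqP; rewrite oner_eq0.
exists (`|u|^-1 *: u); rewrite rV_normZ normfV normr_id mulVf//.
Qed.

Lemma boundary_ray A x u (M : R) : closed A -> bounded_by M A -> A x -> `|u| = 1 ->
  exists2 s : R, 0 <= s & boundary A (x + s *: u).
Proof.
move=> cA MA Ax u1.
pose T := M + `|x| + 1.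
have T0 : 0 < T by have := MA _ Ax; have := normr_ge0 x; rewrite /T; lra.
have nAy : ~ A (x + T *: u).
  move=> /MA; rewrite leNgt => /negP; apply.
  have := lerB_normD (T *: u) x.
  by rewrite [T *: u + x]addrC rV_normZ u1 mulr1 gtr0_norm// /T; lra.
have [t t01 bt] := boundary_segment cA Ax nAy.
exists (t * T); first by apply: mulr_ge0; lra.
rewrite (_ : _ + _ = (1 - t) *: x + t *: (x + T *: u))//.
by apply/rowP => i; rewrite !mxE; ring.
Qed.

Lemma translate_scaleE K x r y : 0 < r ->
  translate_scale x r K y <-> K (r^-1 *: (y - x)).
Proof.
move=> r0; split.
  move=> [k Kk <-]; rewrite [x + _]addrC addrK scalerA mulVf ?scale1r//; lra.
move=> Ky; exists (r^-1 *: (y - x)) => //.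
by rewrite scalerA mulfV ?scale1r ?subrKC//; lra.
Qed.

Lemma closed_translate_scale K x r : 0 < r -> closed K ->
  closed (translate_scale x r K).
Proof.
move=> r0 /closedP cK; apply/closedP => y h; apply/translate_scaleE => //.
apply: cK => e e0; have [z /translate_scaleE Kz zy] := h (r * e) (mulr_gt0 r0 e0).
exists (r^-1 *: (z - x)); first exact: Kz.
rewrite -scalerBr opprB addrA subrK rV_normZ gtr0_norm ?invr_gt0//.
by rewrite mulrC ltr_pdivrMr// mulrC.
Qed.

Lemma translate_translate_scale K x v r : 
  translate v (translate_scale x r K) = translate_scale (x + v) r K.
Proof.
apply/seteqP; split => y [k Kk h]; exists k => //.
  by rewrite addrAC h subrK.
by rewrite -h addrAC addrK.
Qed.

End convexity.

(** * Covering radii and convexity *)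

Section constant_density.
Context {R : realType} {N : nat}.
Variables (K G : set 'rV[R]_N) (a : R -> R) (CK eK MG : R).
Hypothesis N_gt0 : (0 < N)%N.
Hypotheses (closedK : closed K) (segK : segment_closed K)
  (boundK : bounded_by CK K) (CK_gt0 : 0 < CK)
  (eK_gt0 : 0 < eK) (ballK : ball_sub K 0 eK).
Hypotheses (closedG : closed G) (boundG : bounded_by MG G) (interiorG : G° !=set0).
Hypothesis volG : forall (x : 'rV[R]_N) (r : R), boundary G x -> 0 < r ->
  vol (G `&` translate_scale x r K) = a r.
Hypothesis a_gt0 : forall r : R, 0 < r -> 0 < a r.
Implicit Types (x y z g u v w : 'rV[R]_N) (r e : R).

Let bbG : bounded_borel G.
Proof. by split; [exact: borel_closed|exists MG]. Qed.

Let borelK x r : 0 < r -> borel (translate_scale x r K).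
Proof. by move=> r0; apply: borel_closed; exact: closed_translate_scale. Qed.

(** At a boundary point a small translate of [r K] fits in the ball, and [a r > 0] bounds the volume
    from below. *)
Lemma vol_ball_gt0 g e : G g -> 0 < e -> 0 < vol (G `&` ball g e).
Proof.
move=> Gg e0; have bGb := bounded_borelI bbG (borel_ball g e).
have [Gi|nGi] := pselect (G° g).
  apply: (vol_gt0 bGb); exact: (filterI Gi (nbhsx_ballx g e e0)).
have r0 : 0 < e / (2 * CK) by rewrite divr_gt0// mulr_gt0.
have bg : boundary G g by exact/closed_boundary.
apply: lt_le_trans (a_gt0 r0) _; rewrite -(volG bg r0).
apply: le_vol => //; first by apply: borelI; [exact: bbG.1|exact: borelK].
move=> y [Gy [k /boundK kC ky]]; split => //.
rewrite -ball_normE /= -ky opprD addrA subrr add0r normrN rV_normZ gtr0_norm//.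
rewrite mulrAC ltr_pdivrMr ?mulr_gt0//.
by rewrite ltr_pM2l//; have := CK_gt0; lra.
Qed.

(** Covering is visible in the volume: [a r = vol G], so [y + r K] misses only a null part of [G].
    That part is relatively open in [G], hence empty by [vol_ball_gt0]. *)
Lemma sub_translate_scale_boundary x y r : 0 < r -> boundary G x -> boundary G y ->
  G `<=` translate_scale x r K -> G `<=` translate_scale y r K.
Proof.
move=> r0 bx by_ Gx g Gg; apply: contrapT => ng.
have : vol G = vol (G `&` translate_scale y r K).
  by rewrite (volG by_ r0) -(volG bx r0); congr vol; rewrite setIidl.
rewrite [X in X = _](vol_splitI bbG (borelK y r0)) => h.
have [e e0 eP] : exists2 e, 0 < e & ball g e `<=` ~` translate_scale y r K.
  have : nbhs g (~` translate_scale y r K).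
    apply: open_nbhs_nbhs; split => //; apply: closed_openC.
    exact: closed_translate_scale.
  by move=> /nbhs_ballP[e /= e0 he]; exists e.
suff : 0 < vol (G `\` translate_scale y r K) by lra.
apply: lt_le_trans (vol_ball_gt0 Gg e0) _.
apply: le_vol.
- by apply: borelI; [exact: bbG.1|exact: borel_ball].
- by apply: bounded_borelD => //; exact: borelK.
- by move=> w [Gw /eP].
Qed.

(* [x] lies between two boundary points, and [g - r K] is convex for each [g]. *)
Lemma sub_translate_scale x r : 0 < r ->
  (forall y, boundary G y -> G `<=` translate_scale y r K) -> G x ->
  G `<=` translate_scale x r K.
Proof.
move=> r0 GK Gx g Gg.
have [u u1] := @exists_unit_vector R N N_gt0.
have [s s0 bs] := boundary_ray closedG boundG Gx u1.
have [|t t0 bt] := boundary_ray closedG boundG Gx (u := - u); first by rewrite normrN.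
have [s_eq0|s_neq0] := eqVneq s 0.
  by move: bs; rewrite s_eq0 scale0r addr0 => /GK; apply.
have s_gt0 : 0 < s by rewrite lt_neqAle eq_sym s_neq0.
apply/translate_scaleE => //.
have := GK _ bs _ Gg; have := GK _ bt _ Gg.
move=> /(translate_scaleE _ _ _ r0) h1 /(translate_scaleE _ _ _ r0) h2.
have := segK h2 h1 (a := t / (s + t)) (b := s / (s + t)).
rewrite (_ : _ + _ = r^-1 *: (g - x)).
  by apply; [apply: divr_ge0; lra|apply: divr_ge0; lra|field; lra].
by apply/rowP => i; rewrite !mxE; field; lra.
Qed.

Let covers := [set r | 0 < r /\ forall y, boundary G y -> G `<=` translate_scale y r K].

Let diamG x y : G x -> G y -> `|x - y| <= 2 * MG.
Proof. by move=> /boundG hx /boundG hy; have := ler_normB x y; lra. Qed.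

Let MG_ge0 : 0 <= MG.
Proof. by have [x /interior_subset /boundG h] := interiorG; have := normr_ge0 x; lra. Qed.

Let boundary_neq0 : boundary G !=set0.
Proof.
have [u u1] := @exists_unit_vector R N N_gt0.
have [x /interior_subset Gx] := interiorG.
by have [s _ bs] := boundary_ray closedG boundG Gx u1; exists (x + s *: u).
Qed.

Let covers_neq0 : covers !=set0.
Proof.
pose r := (2 * MG + 1) / eK.
have M0 := MG_ge0; have eK0 := eK_gt0.
have r0 : 0 < r by rewrite divr_gt0//; lra.
exists r; split => // y /(closed_boundary _ closedG)[Gy _] g Gg.
apply/translate_scaleE => //; apply: ballK.
rewrite subr0 rV_normZ gtr0_norm ?invr_gt0// /r invf_div.
have := diamG Gg Gy => h.
rewrite mulrAC ltr_pdivrMr; last by lra.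
by rewrite ltr_pM2l//; lra.
Qed.

Let covers_lb : exists2 l, 0 < l & lbound covers l.
Proof.
have [u u1] := @exists_unit_vector R N N_gt0.
have [z /interior_ball_sub[e e0 zG]] := interiorG.
have [x bx] := boundary_neq0.
exists (e / (2 * CK)); first by rewrite divr_gt0// mulr_gt0.
move=> r [r0 /(_ _ bx) Gx].
have Gp : G (z + (e / 2) *: u).
  by apply: zG; rewrite addrAC subrr add0r rV_normZ u1 mulr1 gtr0_norm; lra.
have Gm : G (z - (e / 2) *: u).
  by apply: zG; rewrite addrAC subrr add0r normrN rV_normZ u1 mulr1 gtr0_norm; lra.
have [k /boundK kC kp] := Gx _ Gp; have [l /boundK lC lm] := Gx _ Gm.
have : `|r *: (k - l)| <= r * (2 * CK).
  rewrite rV_normZ gtr0_norm// ler_pM2l//.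
  by have := ler_normB k l; lra.
have -> : r *: (k - l) = e *: u.
  have -> : r *: (k - l) = (x + r *: k) - (x + r *: l).
    by apply/rowP => i; rewrite !mxE; ring.
  by rewrite kp lm; apply/rowP => i; rewrite !mxE; field.
by rewrite rV_normZ u1 mulr1 gtr0_norm// ler_pdivrMr// mulr_gt0.
Qed.

(** If a convex combination [y] were missing, a boundary point [x] would lie between an interior
    point and [y]. Every covering radius could then be divided by the same [1 + d], contradicting
    the positivity of their infimum. *)
Lemma segment_closed_body : segment_closed G.
Proof.
move=> g1 g2 c1 c2 G1 G2 c10 c20 c12; apply: contrapT.
set y := _ + _ => nGy.
have [z /interior_ball_sub[e e0 zG]] := interiorG.
have Gz : G z by apply: zG; rewrite subrr normr0.
have [t t01] := boundary_segment closedG Gz nGy.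
set x := _ + _ => bx.
have [Gx _] := (closed_boundary _ closedG).1 bx.
have t1 : t < 1.
  rewrite lt_neqAle; apply/andP; split; last by lra.
  by apply/eqP => te; apply: nGy; move: Gx; rewrite /x te subrr scale0r add0r scale1r.
pose e' := (1 - t) * e.
have e'0 : 0 < e' by apply: mulr_gt0 => //; lra.
(* [e'] is the radius of a ball about [x] lying in every convex set that contains [G]; [d] makes
   [d * |g - x| < e'] for all [g] in [G] at once. *)
have M0 := MG_ge0; pose d := e' / (2 * MG + 1).
have d0 : 0 < d by rewrite divr_gt0//; lra.
have shrink r : covers r -> covers (r / (1 + d)).
  move=> [r0 Gr]; have rd0 : 0 < r / (1 + d) by rewrite divr_gt0//; lra.
  split => // y'; move: y'.
  suff Gx' : G `<=` translate_scale x (r / (1 + d)) K.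
    by move=> y' by'; exact: (sub_translate_scale_boundary rd0 bx).
  move=> g Gg; apply/translate_scaleE => //.
  pose D : set 'rV[R]_N := [set w | K (r^-1 *: (g - w))].
  have DG : G `<=` D.
    by move=> w Gw; apply/(translate_scaleE _ _ _ r0); exact: sub_translate_scale.
  have segD : segment_closed D.
    move=> w1 w2 b1 b2 D1 D2 b10 b20 b12.
    rewrite /D /= (_ : _ *: _ = b1 *: (r^-1 *: (g - w1)) + b2 *: (r^-1 *: (g - w2))).
      exact: segK.
    by apply/rowP => i; rewrite !mxE (_ : b2 = 1 - b1); [ring|lra].
  have xD : ball_sub D x e'.
    apply: segment_closed_ball_sub => //; [|by apply: segD => //; exact: DG|lra|lra|lra].
    by move=> w /zG /DG.
  (* For [w = x - d (g - x)] one has [g - w = (1 + d) (g - x)], so [w] in [D] says that [g] lies in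
     [x + (r / (1 + d)) K]. *)
  have := xD (x - d *: (g - x)).
  rewrite /D /= (_ : (r / (1 + d))^-1 *: (g - x) = r^-1 *: (g - (x - d *: (g - x)))).
    apply; rewrite addrAC subrr add0r normrN rV_normZ gtr0_norm//.
    rewrite /d mulrAC ltr_pdivrMr; last by lra.
    by rewrite ltr_pM2l//; have := diamG Gg Gx; lra.
  by apply/rowP => i; rewrite !mxE; field; lra.
have [l l0 lb] := covers_lb.
have infc : has_inf covers by split; [exact: covers_neq0|exists l].
pose r0 := inf covers.
have r0_gt0 : 0 < r0.
  by apply: lt_le_trans l0 _; apply: lb_le_inf.
have : r0 * (1 + d) <= r0.
  apply: lb_le_inf => // r /shrink rd.
  rewrite -ler_pdivlMr; last by lra.
  by apply: ge_inf => //; exists l.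
by rewrite -subr_ge0 (_ : _ - _ = - (r0 * d)); [have := mulr_gt0 r0_gt0 d0; lra|ring].
Qed.

End constant_density.

(** * Thin layers along the boundary *)

Section layers.
Context {R : realType} {N : nat}.
Implicit Types (A B G X Y : set 'rV[R]_N) (x y z v w e : 'rV[R]_N).

(* The layer [(G + v) \ G] and its translates by multiples of [v] are pairwise *)
(* disjoint, and about [1 / |v|] of them fit in a fixed ball.                 *)
Lemma vol_layer_le G (M : R) : closed G -> segment_closed G -> bounded_by M G ->
  exists2 C : R, 0 <= C & forall v, vol (translate v G `\` G) <= C * `|v|.
Proof.
move=> cG segG MG.
have bbG : bounded_borel G by split; [exact: borel_closed|exists M].
pose B : set 'rV[R]_N := ball 0 (M + 3).
have bbB : bounded_borel B.
  split; first exact: borel_ball.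
  exists (M + 3) => x; rewrite /B -ball_normE /= sub0r normrN => h; exact: ltW.
have vG0 := vol_ge0 bbG.1; have vB0 := vol_ge0 bbB.1.
(* The term [vol G] serves [|v| >= 1]; [2 * vol B] comes from the packing, where
   [n >= 1 / (2 |v|)]. *)
exists (vol G + 2 * vol B); first by lra.
move=> v; set E := _ `\` _.
have bbE : bounded_borel E.
  by apply: bounded_borelD; [exact: bounded_borel_translate|exact: bbG.1].
have vE0 := vol_ge0 bbE.1.
have [v1|v1] := leP 1 `|v|.
  have : vol E <= vol G.
    rewrite -(vol_translate v bbG.1); apply: le_vol; [exact: bbE.1| |by move=> x []].
    exact: bounded_borel_translate.
  have : 0 <= (vol G + 2 * vol B) * (`|v| - 1) by apply: mulr_ge0; lra.
  by rewrite mulrBr mulr1; lra.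
have [v0|v0] := eqVneq v 0.
  rewrite (_ : E = set0).
    by rewrite vol0 mulr_ge0//; lra.
  by apply/seteqP; split => // x [+ nGx]; rewrite /translate v0 /= subr0.
have nv0 : 0 < `|v| by rewrite normr_gt0.
pose n := Num.truncn (`|v|^-1).
have /andP[n1 n2] : n%:R <= `|v|^-1 < n.+1%:R by rewrite truncn_itv// invr_ge0 ltW.
have iv1 : 1 < `|v|^-1 by rewrite invf_gt1.
have n_gt0 : (0 < n)%N.
  by rewrite lt0n; apply/eqP => n0; move: n2; rewrite n0; lra.
have : \sum_(j < n) vol (translate (j%:R *: v) E) <= vol B.
  apply: (@vol_packing _ _ _ (fun j => translate (j%:R *: v) E)) => //.
    move=> j jn; split; first exact: borel_translate bbE.1.
    move=> x [/MG h _]; rewrite /B -ball_normE /= sub0r normrN.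
    have jv : `|j%:R *: v| <= 1.
      rewrite rV_normZ normr_nat -ler_pdivlMr// mul1r (le_trans _ n1)// ler_nat.
      exact: ltnW.
    have -> : x = (x - j%:R *: v - v) + j%:R *: v + v.
      by apply/rowP => i; rewrite !mxE; ring.
    have := ler_normD (x - j%:R *: v - v + j%:R *: v) v.
    have := ler_normD (x - j%:R *: v - v) (j%:R *: v).
    by lra.
  (* [x - j v] lies on the segment from [x - (j + 1) v] to [x - (i + 1) v], both in [G]. *)
  move=> i j /andP[ij _]; apply/seteqP; split => // x [[Gi _] [Gj nGj]]; apply: nGj.
  have ij1 : (i.+1%:R : R) <= j%:R by rewrite ler_nat.
  move: ij1; rewrite -natr1 => ij1.
  have d0 : 0 < j%:R - i%:R :> R by lra.
  have := segG _ _ ((j%:R - i%:R)^-1) ((j%:R - i%:R - 1) / (j%:R - i%:R)) Gi Gj.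
  rewrite (_ : _ + _ = x - j%:R *: v); last first.
    by apply/rowP => k; rewrite !mxE; field; lra.
  apply; [by rewrite invr_ge0; lra|by apply: divr_ge0; lra|by field; lra].
rewrite (eq_bigr (fun=> vol E)); last by move=> j _; exact: vol_translate bbE.1.
rewrite sumr_const card_ord -mulr_natr => h.
have nn : `|v|^-1 <= 2 * n%:R.
  have : (1 : R) <= n%:R by rewrite ler1n.
  by move: n2; rewrite -natr1; lra.
have : vol E <= 2 * vol B * `|v|.
  rewrite -ler_pdivrMr//.
  have : vol E * `|v|^-1 <= vol E * (2 * n%:R) by apply: ler_wpM2l.
  by lra.
have : 0 <= vol G * `|v| by apply: mulr_ge0; lra.
by rewrite mulrDl; lra.
Qed.

Lemma ball_sub_interior A z (e : R) : 0 < e -> ball_sub A z e -> A° z.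
Proof. by move=> e0 zA; apply/interior_ball_sub; exists e. Qed.

(* Near a boundary point [x], translates by multiples of [s *: e] of the layer *)
(* that [G] gains when moved by [- s *: e] cover a fixed ball lying outside G. *)
Lemma vol_layer_ge G x e (l rho tau s : R) : closed G -> segment_closed G ->
  boundary G x -> 0 < rho -> ball_sub G (x + l *: e) rho ->
  0 < tau -> 2 * tau <= l -> 0 < s -> s <= tau ->
  s * vol (ball (0 : 'rV[R]_N) (tau * rho / l)) <=
  3 * tau * vol (ball x (tau * rho / l + 3 * tau * `|e|) `&`
                 (translate (- (s *: e)) G `\` G)).
Proof.
move=> cG segG bx rho0 xG tau0 taul s0 stau.
have [Gx nGx] := (closed_boundary _ cG).1 bx.
have l0 : 0 < l by lra.
set sg := tau * rho / l; have sg0 : 0 < sg by rewrite divr_gt0// mulr_gt0.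
(* The cone with apex [x] over the ball at [x + l *: e] contains a ball of radius [sg] about each
   axis point from [tau] to [l]. *)
have below t : tau <= t <= l -> ball_sub G (x + t *: e) sg.
  move=> tP w wP.
  have := segment_closed_ball_sub (a := t / l) (b := 1 - t / l) segG xG Gx.
  rewrite (_ : _ *: _ + _ = x + t *: e); last first.
    by apply/rowP => i; rewrite !mxE; field; lra.
  apply => //.
  - by rewrite divr_gt0//; lra.
  - by rewrite subr_ge0 ler_pdivrMr//; lra.
  - by lra.
  - apply: lt_le_trans wP _; rewrite /sg mulrAC ler_pM2r//.
    by rewrite ler_pM2r ?invr_gt0//; lra.
(* Otherwise the reflection of [w] in [x], a point near [x + tau *: e], is interior to [G], and so
   is the midpoint [x]. *)
have above w : `|w - (x - tau *: e)| < sg -> ~ G w.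
  move=> wP Gw; apply: nGx.
  pose d := sg - `|w - (x - tau *: e)|.
  have d0 : 0 < d by rewrite /d; lra.
  have Gr : ball_sub G (2 *: x - w) d.
    move=> u uP; apply: (below tau); first by lra.
    have := ler_normD (u - (2 *: x - w)) (- (w - (x - tau *: e))).
    rewrite normrN (_ : u - (2 *: x - w) + _ = u - (x + tau *: e)).
      by rewrite /d in uP; lra.
    by apply/rowP => i; rewrite !mxE; ring.
  have := segment_closed_ball_sub (a := 1/2) (b := 1/2) segG Gr Gw.
  rewrite (_ : _ *: _ + _ = x); last by apply/rowP => i; rewrite !mxE; field.
  by move=> h; apply: (ball_sub_interior _ (h _ _ _)); lra.
set E := _ `&` _.
pose D : set 'rV[R]_N := ball (x - tau *: e) sg.
have bbD y r : bounded_borel (ball (y : 'rV[R]_N) r).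
  split; first exact: borel_ball.
  exists (`|y| + r) => u; rewrite -ball_normE /= distrC => h.
  by have := ler_normD (u - y) y; rewrite subrK; lra.
have bG : borel G by exact: borel_closed.
have bbE : bounded_borel E.
  by apply: bounded_borelI => //; apply: borelD => //; exact: borel_translate.
(* The least [n] with [n * s > 2 * tau]; since [s <= tau], [n * s <= 3 * tau], the factor in the
   conclusion. *)
pose n := (Num.truncn (2 * tau / s)).+1.
have n0 : 0 <= 2 * tau / s by rewrite divr_ge0//; lra.
have /andP[n1 n2] := truncn_itv n0.
have {}n1 : n%:R * s <= 2 * tau + s.
  rewrite /n -natr1 mulrDl mul1r lerD2r -ler_pdivlMr//.
have {}n2 : 2 * tau < n%:R * s by rewrite -ltr_pdivrMr.
have Dn w : D w -> exists2 j, (j < n)%N & translate (- ((j%:R * s) *: e)) E w.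
  rewrite /D -ball_normE /= distrC => wD.
  have Gn : G (w + (n%:R * s) *: e).
    apply: (below (n%:R * s - tau)); first by lra.
    rewrite (_ : w + _ - _ = w - (x - tau *: e))//.
    by apply/rowP => i; rewrite !mxE; ring.
  (* Walking from [w] in steps [s *: e], the last point before [G] is first met lies in the
     layer. *)
  have exn : exists m, `[< G (w + (m%:R * s) *: e) >] by exists n; apply/asboolP.
  have [m /asboolP Gm minm] := ex_minnP exn.
  case: m Gm minm => [|m] Gm minm.
    by move: Gm; rewrite mul0r scale0r addr0 => /(above _ wD).
  have mn : (m < n)%N by apply: minm; exact/asboolP.
  exists m => //; rewrite /translate /= opprK; split; last split.
  - rewrite -ball_normE /= distrC.
    have ms : m%:R * s <= 2 * tau.
      have : (m.+1%:R : R) * s <= n%:R * s by rewrite ler_pM2r// ler_nat.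
      by rewrite -natr1 mulrDl mul1r; lra.
    have ms0 : 0 <= m%:R * s by rewrite mulr_ge0//; lra.
    have := ler_normD (w - (x - tau *: e)) ((m%:R * s - tau) *: e).
    rewrite (_ : w - (x - tau *: e) + _ = w + (m%:R * s) *: e - x); last first.
      by apply/rowP => i; rewrite !mxE; ring.
    rewrite rV_normZ => h.
    have : `|m%:R * s - tau| * `|e| <= 3 * tau * `|e|.
      by apply: ler_wpM2r => //; rewrite ler_norml; lra.
    by lra.
  - rewrite /translate /= opprK (_ : w + _ + _ = w + (m.+1%:R * s) *: e)//.
    by apply/rowP => i; rewrite !mxE -natr1; ring.
  - by move=> Gm'; have := minm m; rewrite ltnn => /(_ (asboolT Gm')).
have := @vol_cover _ _ n (fun j => translate (- ((j%:R * s) *: e)) E) D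
  (fun j _ => bounded_borel_translate _ bbE) (bbD _ _) Dn.
rewrite (eq_bigr (fun=> vol E)); last by move=> j _; exact: vol_translate bbE.1.
rewrite sumr_const card_ord -[vol E *+ n]mulr_natr.
have -> : vol D = vol (ball (0 : 'rV[R]_N) sg).
  rewrite -(vol_translate (x - tau *: e) (borel_ball 0 sg)); congr vol.
  apply/funext => w; rewrite /translate /D -!ball_normE /=.
  by rewrite sub0r normrN distrC.
have vE0 := vol_ge0 bbE.1.
move=> h; apply: (@le_trans _ _ (s * (vol E * n%:R))).
  by rewrite ler_pM2l.
rewrite mulrCA mulrC ler_wpM2r//.
by rewrite mulrC; lra.
Qed.

End layers.

(** * Second differences at boundary points *)

Section second_difference.
Context {R : realType} {N : nat}.
Implicit Types (A B G X Y K : set 'rV[R]_N) (x y z v w e p : 'rV[R]_N).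

Lemma translateI v A B : translate v (A `&` B) = translate v A `&` translate v B.
Proof. by []. Qed.

Lemma translateK v A : translate v (translate (- v) A) = A.
Proof. by apply/funext => x; rewrite /translate /= opprK subrK. Qed.

Let psi v A X : R := vol (X `&` translate v A) - vol (X `&` A).

Let psi_split v A X Y : bounded_borel X -> borel A -> borel Y ->
  psi v A X = psi v A (X `&` Y) + psi v A (X `\` Y).
Proof.
move=> bX bA bY.
have split B : borel B ->
    vol (X `&` B) = vol ((X `&` Y) `&` B) + vol ((X `\` Y) `&` B).
  move=> bB; rewrite (vol_splitI (bounded_borelI bX bB) bY) setIAC.
  by congr (_ + vol _); rewrite !setDE setIAC.
by rewrite /psi !split//; [ring|exact: borel_translate].
Qed.

(* Telescoping, as [A i - v] and [A i + v] lie in [A i.+1] *)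
Let psi_sum v (A : nat -> set 'rV[R]_N) X n : bounded_borel X ->
  (forall i, borel (A i)) ->
  (forall i, translate v (A i) `<=` A i.+1) ->
  (forall i, A i `<=` translate v (A i.+1)) ->
  `|\sum_(i < n) psi v (A i.+1) X| <= vol X.
Proof.
move=> bX bA Av vA.
have bXA i := bounded_borelI bX (bA i).
have bXvA i := bounded_borelI bX (borel_translate v (bA i)).
have up i : vol (X `&` translate v (A i)) <= vol (X `&` A i.+1).
  by apply: le_vol; [exact: (bXvA i).1|exact: bXA|exact: setIS].
have down i : vol (X `&` A i) <= vol (X `&` translate v (A i.+1)).
  by apply: le_vol; [exact: (bXA i).1|exact: bXvA|exact: setIS].
have le_X i : 0 <= vol (X `&` A i) <= vol X.
  by rewrite vol_ge0 ?le_vol//; [exact: (bXA i).1|exact: (bXA i).1].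
have h1 : \sum_(i < n) psi v (A i.+1) X <= vol (X `&` A n.+1) - vol (X `&` A 1%N).
  elim: n => [|n IH]; first by rewrite big_ord0 subrr.
  by rewrite big_ord_recr /= /psi; have := up n.+1; move: IH; rewrite /psi; lra.
have h2 : vol (X `&` A 0%N) - vol (X `&` A n) <= \sum_(i < n) psi v (A i.+1) X.
  elim: n {h1} => [|n IH]; first by rewrite big_ord0 subrr.
  by rewrite big_ord_recr /= /psi; have := down n; move: IH; rewrite /psi; lra.
have := le_X n; have := le_X n.+1; have := le_X 0%N; have := le_X 1%N.
by rewrite ler_norml; lra.
Qed.

(** Translating by [v] turns the second difference into [psi] of [translate v G] minus [psi] of [G].
    The common part of the two sets cancels, and [psi_sum] bounds what is left by a volume
    independent of [n]. *)
Lemma vol_second_difference_sum G v (A : nat -> set 'rV[R]_N) n : bounded_borel G ->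
  (forall i, borel (A i)) ->
  (forall i, translate v (A i) `<=` A i.+1) ->
  (forall i, A i `<=` translate v (A i.+1)) ->
  \sum_(i < n) (2 * vol (G `&` A i.+1) - vol (G `&` translate v (A i.+1)) -
      vol (G `&` translate (- v) (A i.+1))) <=
  vol (translate v G `\` G) + vol (translate (- v) G `\` G).
Proof.
move=> bG bA Av vA.
have bvG := bounded_borel_translate v bG.
have -> : vol (translate (- v) G `\` G) = vol (G `\` translate v G).
  rewrite -(vol_translate v); last exact: (borelD (borel_translate (- v) bG.1) bG.1).
  by rewrite setDE translateI translateK -setDE.
have term i : 2 * vol (G `&` A i.+1) - vol (G `&` translate v (A i.+1)) -
      vol (G `&` translate (- v) (A i.+1)) =
    psi v (A i.+1) (translate v G `\` G) - psi v (A i.+1) (G `\` translate v G).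
  have -> : vol (G `&` translate (- v) (A i.+1)) = vol (translate v G `&` A i.+1).
    rewrite -(vol_translate v); first by rewrite translateI translateK.
    by apply: borelI; [exact: bG.1|exact: borel_translate].
  have e1 := psi_split v bG (bA i.+1) bvG.1.
  have e2 := psi_split v bvG (bA i.+1) bG.1.
  rewrite [translate v G `&` G]setIC in e2.
  have e3 : vol (translate v G `&` translate v (A i.+1)) = vol (G `&` A i.+1).
    by rewrite -translateI vol_translate//; apply: borelI => //; exact: bG.1.
  have e4 : psi v (A i.+1) (translate v G) =
     vol (G `&` A i.+1) - vol (translate v G `&` A i.+1) by rewrite /psi e3.
  have e5 : psi v (A i.+1) G =
     vol (G `&` translate v (A i.+1)) - vol (G `&` A i.+1) by [].
  by lra.
rewrite (eq_bigr (fun i : 'I_n => psi v (A i.+1) (translate v G `\` G) -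
  psi v (A i.+1) (G `\` translate v G))); last by move=> i _; exact: term.
rewrite sumrB.
have s1 := psi_sum n (bounded_borelD bvG bG.1) bA Av vA.
have s2 := psi_sum n (bounded_borelD bG bvG.1) bA Av vA.
move: s1 s2; rewrite !ler_norml; lra.
Qed.

Lemma segment_closed_shift G y (s l : R) e : segment_closed G -> G y ->
  G (y + l *: e) -> 0 <= s <= l -> 0 < l -> G (y + s *: e).
Proof.
move=> segG Gy Gl sl l0.
have := segG _ _ (1 - s / l) (s / l) Gy Gl.
rewrite (_ : _ *: y + _ = y + s *: e); last first.
  by apply/rowP => i; rewrite !mxE; field; lra.
by apply; [rewrite subr_ge0 ler_pdivrMr//; lra|apply: divr_ge0; lra|lra].
Qed.

(** Convexity of [K] gives [r K + t K] inside [(r + t) K]. *)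
Lemma translate_scale_grow K x u w (r t : R) : segment_closed K -> 0 < r -> 0 < t ->
  translate_scale x r K u -> K (t^-1 *: w) -> translate_scale x (r + t) K (u + w).
Proof.
move=> segK r0 t0 [k Kk <-] Kw; have rt0 : 0 < r + t by exact: addr_gt0.
apply/translate_scaleE => //.
have := segK _ _ (r / (r + t)) (t / (r + t)) Kk Kw.
rewrite (_ : _ *: k + _ = (r + t)^-1 *: (x + r *: k + w - x)).
  by apply; [apply: divr_ge0; lra|apply: divr_ge0; lra|field; lra].
by apply/rowP => i; rewrite !mxE; field; lra.
Qed.

(** Moving the centre by [s *: e] amounts to moving [G] by [- (s *: e)]. Inside [x + r K] nothing is
    lost, as [r * CK < rho] puts [y + l *: e] in [G]; the layer of [vol_layer_ge] is gained, its
    ball lying in [x + r K] by the last hypothesis. *)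
Lemma vol_translate_scale_gain K G x e (CK eK MG l rho tau s r : R) :
  closed K -> bounded_by CK K -> ball_sub K 0 eK ->
  closed G -> segment_closed G -> bounded_by MG G -> boundary G x ->
  0 < rho -> ball_sub G (x + l *: e) rho ->
  0 < tau -> 2 * tau <= l -> 0 < s -> s <= tau ->
  0 < r -> r * CK < rho -> tau * rho / l + 3 * tau * `|e| <= r * eK ->
  vol (G `&` translate_scale x r K) +
    vol (ball (0 : 'rV[R]_N) (tau * rho / l)) / (3 * tau) * s <=
  vol (G `&` translate_scale (x + s *: e) r K).
Proof.
move=> cK CKK ballK cG segG MGG bx rho0 xG tau0 taul s0 stau r0 rCK reK.
have [Gx _] := (closed_boundary _ cG).1 bx.
have bbG : bounded_borel G by split; [exact: borel_closed|exists MG].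
have bK y : borel (translate_scale y r K).
  by apply: borel_closed; exact: closed_translate_scale.
have bmG : bounded_borel (translate (- (s *: e)) G) by exact: bounded_borel_translate.
have -> : vol (G `&` translate_scale (x + s *: e) r K) =
   vol (translate (- (s *: e)) G `&` translate_scale x r K).
  rewrite -(vol_translate (- (s *: e))); last by apply: borelI; [exact: bbG.1|exact: bK].
  by rewrite translateI translate_translate_scale addrK.
have sub1 : G `&` translate_scale x r K `<=` translate (- (s *: e)) G.
  move=> y [Gy [k /CKK kC ky]]; rewrite /translate /= opprK.
  apply: (@segment_closed_shift G y s l e) => //; [|lra|lra].
  apply: xG; rewrite -ky (_ : _ - _ = r *: k).
    by rewrite rV_normZ gtr0_norm// (le_lt_trans _ rCK)// ler_pM2l.
  by apply/rowP => i; rewrite !mxE; ring.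
rewrite (vol_splitI (bounded_borelI bmG (bK x)) bbG.1).
set X := translate _ _ `&` translate_scale x r K.
have -> : X `&` G = G `&` translate_scale x r K.
  apply/seteqP; split => y; first by move=> [[_ ?] ?].
  by move=> yP; split; [split; [exact: sub1|exact: yP.2]|exact: yP.1].
rewrite lerD2l mulrAC ler_pdivrMr ?mulr_gt0// mulrC.
apply: le_trans (vol_layer_ge cG segG bx rho0 xG tau0 taul s0 stau) _.
rewrite mulrC ler_pM2r ?mulr_gt0//; apply: le_vol.
- apply: borelI; first exact: borel_ball.
  by apply: borelD; [exact: bmG.1|exact: bbG.1].
- by apply: bounded_borelD bbG.1; exact: bounded_borelI.
- move=> y [yb [Gy nGy]]; split => //; split => //.
  apply/translate_scaleE => //; apply: ballK.
  rewrite subr0 rV_normZ gtr0_norm ?invr_gt0// mulrC ltr_pdivrMr// mulrC.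
  by move: yb; rewrite -ball_normE /= distrC => yb; exact: lt_le_trans reK.
Qed.

(* For each radius [r] in [[r0, 2 * r0]] the translate of [r K] centred at the  *)
(* midpoint [x + s *: e] meets G in at least [kap * s] more volume than those   *)
(* centred on the boundary, while summing over about [1 / |v|] radii leaves a   *)
(* total second difference of order [|v|].                                    *)
Lemma boundary_second_difference K G (a : R -> R) (CK eK MG : R) p e (l rho : R) :
  closed K -> segment_closed K -> bounded_by CK K -> 0 < CK ->
  0 < eK -> ball_sub K 0 eK ->
  closed G -> segment_closed G -> bounded_by MG G ->
  (forall x (r : R), boundary G x -> 0 < r -> vol (G `&` translate_scale x r K) = a r) ->
  0 < l -> 0 < rho -> ball_sub G (p + l *: e) rho ->
  exists2 eta : R, 0 < eta & exists2 C : R, 0 <= C & forall x v (s : R),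
    `|x - p| < eta -> boundary G x -> 0 <= s -> s <= eta -> `|v| <= eta ->
    boundary G (x + s *: e + v) -> boundary G (x + s *: e - v) ->
    s <= C * `|v| ^+ 2.
Proof.
move=> cK segK CKK CK0 eK0 ballK cG segG MGG volG l0 rho0 pG.
have bbG : bounded_borel G by split; [exact: borel_closed|exists MG].
have [C0 C00 layer_le] := vol_layer_le cG segG MGG.
(* For radii up to [2 * r0] the set [x + r K] stays within [rho / 2] of [x]; the other half of [rho]
   pays for passing from [p] to a nearby [x]. *)
have [r0 r00 r0P] : exists2 r0 : R, 0 < r0 & 2 * r0 * CK < rho / 2.
  exists (rho / (8 * CK)); first by rewrite divr_gt0// mulr_gt0.
  by rewrite (_ : _ * CK = rho / 4); [lra|field; lra].
have [tau [tau0 taul sgP]] : exists tau : R, [/\ 0 < tau, 2 * tau <= l &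
    tau * (rho / 2) / l + 3 * tau * `|e| <= r0 * eK].
  pose q := rho / 2 / l + 3 * `|e|.
  have q0 : 0 < q by rewrite ltr_wpDr ?mulr_ge0// !divr_gt0.
  exists (Num.min (l / 2) (r0 * eK / q)).
  have m1 : Num.min (l / 2) (r0 * eK / q) <= l / 2 by rewrite ge_min lexx.
  have m2 : Num.min (l / 2) (r0 * eK / q) <= r0 * eK / q by rewrite ge_min lexx orbT.
  split; [by rewrite lt_min !divr_gt0// mulr_gt0|lra|].
  move: m2; rewrite ler_pdivlMr//; apply: le_trans.
  by rewrite le_eqVlt; apply/orP; left; apply/eqP; rewrite /q; ring.
have [kap kap0 gain] : exists2 kap : R, 0 < kap & forall x (s r : R),
    boundary G x -> ball_sub G (x + l *: e) (rho / 2) -> 0 < s -> s <= tau ->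
    r0 <= r -> r <= 2 * r0 ->
    vol (G `&` translate_scale x r K) + kap * s <=
    vol (G `&` translate_scale (x + s *: e) r K).
  have rho20 : 0 < rho / 2 by lra.
  have sg0 : 0 < tau * (rho / 2) / l by rewrite divr_gt0// mulr_gt0.
  have bbD : bounded_borel (ball (0 : 'rV[R]_N) (tau * (rho / 2) / l)).
    split; first exact: borel_ball.
    exists (tau * (rho / 2) / l) => u.
    by rewrite -ball_normE /= sub0r normrN => h; exact: ltW.
  exists (vol (ball (0 : 'rV[R]_N) (tau * (rho / 2) / l)) / (3 * tau)).
    rewrite divr_gt0 ?mulr_gt0//.
    exact: (vol_gt0 bbD (nbhsx_ballx _ _ sg0)).
  move=> x s r bx xG s0 stau rr0 rb.
  have r_gt0 : 0 < r by lra.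
  apply: (vol_translate_scale_gain cK CKK ballK cG segG MGG bx rho20 xG) => //.
    by apply: le_lt_trans r0P; rewrite ler_pM2r.
  by apply: le_trans sgP _; rewrite ler_pM2r.
have [eta [eta0 eta_rho eta_tau eta_r]] : exists eta : R,
    [/\ 0 < eta, eta <= rho / 2, eta <= tau & 2 * eta <= r0 * eK].
  exists (Num.min (rho / 2) (Num.min tau (r0 * eK / 2))).
  have minP (x y : R) : Num.min x y <= x /\ Num.min x y <= y.
    by rewrite !ge_min !lexx orbT.
  have [h1 h2] := minP (rho / 2) (Num.min tau (r0 * eK / 2)).
  have [h3 h4] := minP tau (r0 * eK / 2).
  split; [|lra|lra|lra].
  by rewrite lt_min divr_gt0//= lt_min tau0 /= divr_gt0// mulr_gt0.
have den0 : 0 < eK * r0 * kap by rewrite mulr_gt0// mulr_gt0.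
(* The 4 combines [n >= r0 / (2 * t)] with [t = 2 |v| / eK]. *)
have C'0 : 0 <= 4 * C0 / (eK * r0 * kap) by apply: divr_ge0; lra.
exists eta => //; exists (4 * C0 / (eK * r0 * kap)) => //.
move=> x v s xp bx s_ge0 seta veta bp bm.
have [Gx nGx] := (closed_boundary _ cG).1 bx.
have [->|s_neq0] := eqVneq s 0; first by rewrite mulr_ge0// exprn_ge0.
have s0 : 0 < s by rewrite lt_neqAle eq_sym s_neq0.
have xG : ball_sub G (x + l *: e) (rho / 2).
  move=> w wP; apply: pG.
  have := ler_normD (w - (x + l *: e)) (x - p).
  rewrite (_ : w - (x + l *: e) + _ = w - (p + l *: e)); first by lra.
  by apply/rowP => i; rewrite !mxE; ring.
have [v_eq0|v_neq0] := eqVneq v 0.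
  exfalso; move: bp; rewrite v_eq0 addr0 => /(closed_boundary _ cG)[_]; apply.
  have := segment_closed_ball_sub (a := s / l) (b := 1 - s / l) segG xG Gx.
  rewrite (_ : _ *: _ + _ = x + s *: e); last first.
    by apply/rowP => i; rewrite !mxE; field; lra.
  have sl0 : 0 < s / l by rewrite divr_gt0.
  have rho20 : 0 < rho / 2 by lra.
  move=> h; apply: (ball_sub_interior (mulr_gt0 sl0 rho20)); apply: h => //; last by lra.
  by rewrite subr_ge0 ler_pdivrMr//; lra.
have v0 : 0 < `|v| by rewrite normr_gt0.
(* With this radius step [t K] contains the vectors of length [|v|], so shifts by [v] and [- v]
   carry [A i] into [A i.+1], as telescoping requires. *)
have [t t0 tE] : exists2 t : R, 0 < t & t * eK = 2 * `|v|.
  by exists (2 * `|v| / eK); [rewrite divr_gt0// mulr_gt0|rewrite divfK// gt_eqF].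
have tr0 : t <= r0 by rewrite -(ler_pM2r eK0); lra.
pose A i := translate_scale (x + s *: e) (r0 + i%:R * t) K.
have rA i : 0 < r0 + i%:R * t by rewrite ltr_wpDr// mulr_ge0// ltW.
have bA i : borel (A i) by apply: borel_closed; exact: closed_translate_scale.
have grow i w u : `|w| = `|v| -> A i u -> A i.+1 (u + w).
  move=> wv Au; rewrite /A -natr1 mulrDl mul1r addrA.
  apply: translate_scale_grow => //; apply: ballK.
  by rewrite subr0 rV_normZ wv gtr0_norm ?invr_gt0// mulrC ltr_pdivrMr//; lra.
have Av i : translate v (A i) `<=` A i.+1.
  by move=> u /(grow i v _ erefl); rewrite subrK.
have vA i : A i `<=` translate v (A i.+1).
  by move=> u /(grow i (- v) _ (normrN v)).
have [n n1 n2] : exists2 n : nat, n%:R * t <= r0 & r0 <= 2 * (n%:R * t).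
  have rt0 : 0 <= r0 / t by rewrite divr_ge0// ltW.
  have /andP[n1 n2] := truncn_itv rt0; exists (Num.truncn (r0 / t)).
    by rewrite -ler_pdivlMr.
  have n_ge1 : (1 : R) <= (Num.truncn (r0 / t))%:R.
    by rewrite ler1n truncn_gt0 ler_pdivlMr// mul1r.
  move: n2; rewrite ltr_pdivrMr// -natr1 mulrDl mul1r.
  by have := ler_pM2r t0 1 (Num.truncn (r0 / t))%:R; rewrite n_ge1 mul1r; lra.
have lower (i : 'I_n) : 2 * (kap * s) <= 2 * vol (G `&` A i.+1) -
   vol (G `&` translate v (A i.+1)) - vol (G `&` translate (- v) (A i.+1)).
  rewrite /A !translate_translate_scale (volG _ _ bp (rA i.+1)) (volG _ _ bm (rA i.+1)).
  rewrite -(volG _ _ bx (rA i.+1)).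
  have it : (i.+1%:R : R) * t <= n%:R * t by rewrite ler_pM2r// ler_nat.
  have it0 : 0 <= (i.+1%:R : R) * t by rewrite mulr_ge0// ltW.
  have h := gain x s (r0 + i.+1%:R * t) bx xG s0.
  have {h} : vol (G `&` translate_scale x (r0 + i.+1%:R * t) K) + kap * s <=
    vol (G `&` translate_scale (x + s *: e) (r0 + i.+1%:R * t) K) by apply: h; lra.
  by lra.
have upper := vol_second_difference_sum n bbG bA Av vA.
have : \sum_(i < n) 2 * (kap * s) <= \sum_(i < n) (2 * vol (G `&` A i.+1) -
   vol (G `&` translate v (A i.+1)) - vol (G `&` translate (- v) (A i.+1))).
  by apply: ler_sum => i _; exact: lower.
rewrite sumr_const card_ord -[X in X <= _]mulr_natr => sumlow.
have lay1 := layer_le v; have := layer_le (- v); rewrite normrN => lay2.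
have {sumlow} main : kap * s * n%:R <= C0 * `|v| by lra.
rewrite mulrAC ler_pdivlMr//.
have ks0 : 0 < kap * s * eK by rewrite !mulr_gt0.
have : kap * s * eK * r0 <= kap * s * eK * (2 * (n%:R * t)) by rewrite ler_pM2l.
rewrite (_ : kap * s * eK * (2 * (n%:R * t)) = 2 * (kap * s * n%:R) * (t * eK)); last by ring.
rewrite tE.
have : 2 * (kap * s * n%:R) * (2 * `|v|) <= 2 * (C0 * `|v|) * (2 * `|v|).
  by rewrite ler_pM2r ?mulr_gt0// ler_pM2l.
by rewrite expr2; lra.
Qed.

End second_difference.

(** * Semiconcave convex functions *)

Section differentiability.
Context {R : realType}.

Definition dot n (a : 'rV[R]_n) (h : 'rV[R]_n) : R := \sum_i a 0 i * h 0 i.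

Lemma dotD n (a x y : 'rV[R]_n) : dot a (x + y) = dot a x + dot a y.
Proof. by rewrite /dot -big_split; apply: eq_bigr => i _; rewrite mxE mulrDr. Qed.

Lemma dotZ n (a x : 'rV[R]_n) (c : R) : dot a (c *: x) = c * dot a x.
Proof. by rewrite /dot mulr_sumr; apply: eq_bigr => i _; rewrite mxE mulrCA. Qed.

Lemma dotN n (a x : 'rV[R]_n) : dot a (- x) = - dot a x.
Proof. by rewrite -scaleN1r dotZ mulN1r. Qed.

Lemma dot_is_linear n (a : 'rV[R]_n) : linear (dot a : 'rV[R]_n -> R^o).
Proof. by move=> c x y; rewrite dotD dotZ. Qed.

HB.instance Definition _ n (a : 'rV[R]_n) :=
  GRing.isLinear.Build R 'rV[R]_n R^o _ (dot a : 'rV[R]_n -> R^o) (dot_is_linear a).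

Lemma dot_le n (a h : 'rV[R]_n) : `|dot a h| <= (\sum_i `|a 0 i|) * `|h|.
Proof.
rewrite /dot mulr_suml (le_trans (ler_norm_sum _ _ _))// ler_sum// => i _.
by rewrite normrM ler_wpM2l// coord_le_norm.
Qed.

Lemma dot_continuous n (a : 'rV[R]_n) : continuous (dot a : 'rV[R]_n -> R^o).
Proof.
apply/linear_bounded_continuous/linear_boundedP.
exists (\sum_i `|a 0 i|); split; first exact: num_real.
move=> M aM x; apply: le_trans (dot_le a x) _.
by rewrite ler_wpM2r// ltW.
Qed.

Lemma differentiable_quadratic (V W : normedModType R) (f : V -> W)
    (L : {linear V -> W}) (y : V) (C d : R) : continuous L ->
  0 < d -> (forall h, `|h| < d -> `|f (y + h) - f y - L h| <= C * `|h| ^+ 2) ->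
  differentiable f y /\ forall v, 'D_v f y = L v.
Proof.
move=> cL d0 fL.
have ff : f \o shift y = cst (f y) + L +o_ 0 id.
  apply/eqaddoP => _/posnumP[e]; near=> h.
  rewrite [X in `|X| <= _](_ : _ = f (y + h) - f y - L h); last first.
    by rewrite -addrA -opprD [y + h]addrC.
  have hd : `|h| < d by near: h; exact: nbhs0_lt.
  apply: le_trans (fL h hd) _; rewrite expr2 mulrA ler_wpM2r//.
  have C1 : 0 < `|C| + 1 by rewrite ltr_wpDl.
  have : `|h| < e%:num / (`|C| + 1).
    by near: h; apply: nbhs0_lt; rewrite divr_gt0.
  rewrite ltr_pdivlMr// => /ltW; apply: le_trans.
  by rewrite mulrC ler_wpM2l// (le_trans (ler_norm C))// lerDl.
have dE := diff_unique cL ff.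
have df : differentiable f y by apply/diff_locallyP; rewrite dE.
by split => // v; rewrite deriveE// dE.
Unshelve. all: by end_near. Qed.

(* A convex function of one variable whose symmetric second differences are    *)
(* [O(t^2)] has equal one-sided derivatives at 0.                             *)
Lemma convex_semiconcave_derivative (g : R -> R) (r C : R) : 0 < r ->
  (forall s t a b, `|s| < r -> `|t| < r -> 0 <= a -> 0 <= b -> a + b = 1 ->
    g (a * s + b * t) <= a * g s + b * g t) ->
  (forall t, `|t| < r -> g t + g (- t) - 2 * g 0 <= C * t ^+ 2) ->
  exists c, forall t, `|t| < r -> 0 <= g t - g 0 - c * t <= C * t ^+ 2.
Proof.
move=> r0 cvx sc.
pose q t := (g t - g 0) / t.
have slopes s t : 0 < s < r -> 0 < t < r -> (g 0 - g (- s)) / s <= q t.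
  move=> sr tr.
  have sl : `|- s| < r by rewrite normrN gtr0_norm; lra.
  have tl : `|t| < r by rewrite gtr0_norm; lra.
  have := cvx (- s) t (t / (s + t)) (s / (s + t)) sl tl.
  rewrite (_ : t / (s + t) * - s + _ = 0); last by field; lra.
  move=> h; have {}h : g 0 <= t / (s + t) * g (- s) + s / (s + t) * g t.
    by apply: h; [apply: divr_ge0; lra|apply: divr_ge0; lra|field; lra].
  rewrite /q ler_pdivrMr; last by lra.
  rewrite mulrAC ler_pdivlMr; last by lra.
  have : (s + t) * g 0 <= t * g (- s) + s * g t.
    rewrite (_ : t * _ + _ = (s + t) * (t / (s + t) * g (- s) + s / (s + t) * g t)).
      by rewrite ler_pM2l//; lra.
    by field; lra.
  by lra.
pose E := [set q t | t in [set t | 0 < t < r]].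
have Elb s : 0 < s < r -> lbound E ((g 0 - g (- s)) / s).
  by move=> sr _ [t tr <-]; exact: slopes.
have r2 : 0 < r / 2 < r by lra.
have E0 : E !=set0 by exists (q (r / 2)); exists (r / 2).
have Einf : has_inf E by split => //; exists ((g 0 - g (- (r / 2))) / (r / 2)); exact: Elb.
(* The right derivative at 0, which by [slopes] dominates the left difference quotients. The upper
   bound at [t] is the second difference bound minus the lower bound at [- t]. *)
pose c := inf E.
have cP t : 0 < t < r -> c * t <= g t - g 0 /\ g 0 - g (- t) <= c * t.
  move=> tr; split.
    rewrite -ler_pdivlMr; last by lra.
    by apply: ge_inf; [exact: Einf.2|exists t].
  rewrite -ler_pdivrMr; last by lra.
  by apply: lb_le_inf => //; exact: Elb.
exists c => t tr.
have := sc t tr.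
have [t0|t0|t0] := ltgtP t 0.
- have := cP (- t); rewrite opprK => -[|h1 h2].
    by rewrite ltr0_norm// in tr; lra.
  by lra.
- have := cP t => -[|h1 h2]; first by rewrite gtr0_norm// in tr; lra.
  by lra.
- by rewrite t0 oppr0 expr2; lra.
Qed.

Lemma jensen_mean n m (f : 'rV[R]_n -> R) (D : set 'rV[R]_n) (z : nat -> 'rV[R]_n) :
  (forall x y a b, D x -> D y -> 0 <= a -> 0 <= b -> a + b = 1 ->
    D (a *: x + b *: y) /\ f (a *: x + b *: y) <= a * f x + b * f y) ->
  (forall i, (i < m.+1)%N -> D (z i)) ->
  D (m.+1%:R^-1 *: \sum_(i < m.+1) z i) /\
  f (m.+1%:R^-1 *: \sum_(i < m.+1) z i) <= m.+1%:R^-1 * \sum_(i < m.+1) f (z i).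
Proof.
move=> cvx; elim: m => [|m IH] Dz.
  by rewrite !big_ord1 invr1 scale1r mul1r; split => //; exact: Dz.
have [|Dm fm] := IH; first by move=> i im; apply: Dz; exact: ltnW.
have m1 : 0 < m.+1%:R :> R by rewrite ltr0n.
have m2 : 0 < m.+2%:R :> R by rewrite ltr0n.
have m2E : m.+2%:R = m.+1%:R + 1 :> R by rewrite -natr1.
rewrite !(big_ord_recr m.+1) /=.
set S := \sum_(i < m.+1) z i in Dm fm *; set F := \sum_(i < m.+1) f (z i) in fm *.
have [] := cvx _ _ (m.+1%:R / m.+2%:R) (m.+2%:R^-1) Dm (Dz m.+1 (ltnSn _)).
- by apply: divr_ge0; lra.
- by rewrite invr_ge0; lra.
- by rewrite -[X in _ + X]mul1r -mulrDl -m2E divff// gt_eqF.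
rewrite (_ : _ *: (_ *: S) + _ = m.+2%:R^-1 *: (S + z m.+1)); last first.
  by apply/rowP => i; rewrite !mxE; field; lra.
move=> D2 f2; split => //; apply: le_trans f2 _.
have : m.+1%:R / m.+2%:R * f (m.+1%:R^-1 *: S) <= m.+1%:R / m.+2%:R * (m.+1%:R^-1 * F).
  by rewrite ler_pM2l//; apply: divr_gt0.
have -> : m.+1%:R / m.+2%:R * (m.+1%:R^-1 * F) = m.+2%:R^-1 * F.
  by rewrite mulrACA divff ?mul1r// gt_eqF.
by rewrite mulrDr lerD2r.
Qed.

(** Along the axes there are derivatives with quadratic remainder; convexity combines them into an
    expansion with linear part [dot (a y)] and uniform quadratic remainder. Comparing expansions at
    two points shows that [a] is Lipschitz. *)
Lemma C11_convex_semiconcave n (f : 'rV[R]_n.+1 -> R) (y0 : 'rV[R]_n.+1) (r C : R) :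
  0 < r -> 0 <= C ->
  (forall x y a b, `|x - y0| < r -> `|y - y0| < r -> 0 <= a -> 0 <= b -> a + b = 1 ->
    f (a *: x + b *: y) <= a * f x + b * f y) ->
  (forall y h, `|y - y0| < r -> `|y + h - y0| < r -> `|y - h - y0| < r ->
    f (y + h) + f (y - h) - 2 * f y <= C * `|h| ^+ 2) ->
  exists2 d : R, 0 < d & C11_on (fun y => `|y - y0| < d) (f : 'rV[R]_n.+1 -> R^o).
Proof.
move=> r0 C0 cvx sc.
pose D : set 'rV[R]_n.+1 := [set x | `|x - y0| < r].
have cvxD x y a b : D x -> D y -> 0 <= a -> 0 <= b -> a + b = 1 ->
    D (a *: x + b *: y) /\ f (a *: x + b *: y) <= a * f x + b * f y.
  move=> Dx Dy a0 b0 ab; split; last exact: cvx.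
  exact: segment_closed_norm_lt.
have near_D y h : `|y - y0| < r / 2 -> `|h| < r / 2 -> D (y + h).
  move=> yr hr; rewrite /D /=; have := ler_normD (y - y0) h.
  by rewrite addrAC; lra.
have e_norm i : `|delta_mx 0 i : 'rV[R]_n.+1| <= 1.
  apply/rV_norm_leP => // j; rewrite !mxE eqxx /=.
  by case: eqP => _; rewrite ?normr1 ?normr0.
have partial (y : 'rV[R]_n.+1) (i : 'I_n.+1) : exists c : R, `|y - y0| < r / 2 -> forall t, `|t| < r / 2 ->
    0 <= f (y + t *: delta_mx 0 i) - f y - c * t <= C * t ^+ 2.
  have [yr|] := ltP `|y - y0| (r / 2); last by exists 0.
  pose g t : R := f (y + t *: delta_mx 0 i).
  have Dg t : `|t| < r / 2 -> D (y + t *: delta_mx 0 i).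
    move=> tr; apply: near_D => //; rewrite rV_normZ (le_lt_trans _ tr)//.
    by rewrite ler_piMr.
  have [|||c cP] := @convex_semiconcave_derivative g (r / 2) C.
  - by lra.
  - move=> s t a b sr tr a0 b0 ab; rewrite /g.
    rewrite (_ : y + _ = a *: (y + s *: delta_mx 0 i) + b *: (y + t *: delta_mx 0 i)).
      exact: (cvxD _ _ _ _ (Dg _ sr) (Dg _ tr) a0 b0 ab).2.
    by apply/rowP => j; rewrite !mxE (_ : b = 1 - a); [ring|lra].
  - move=> t tr; rewrite /g scale0r addr0 scaleNr.
    apply: le_trans (sc y (t *: delta_mx 0 i) _ _ _) _ => //; first lra.
    + exact: Dg.
    + by rewrite -scaleNr; apply: Dg; rewrite normrN.
    apply: ler_wpM2l => //; rewrite -(real_normK (num_real t)).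
    rewrite ler_sqr ?nnegrE// rV_normZ.
    by rewrite ler_piMr.
  - by exists c => _ t /cP; rewrite /g scale0r addr0.
pose a' (y : 'rV[R]_n.+1) (i : 'I_n.+1) : R := projT1 (choice (partial y)) i.
have a'P (y : 'rV[R]_n.+1) i : `|y - y0| < r / 2 -> forall t : R, `|t| < r / 2 ->
    0 <= f (y + t *: delta_mx 0 i) - f y - a' y i * t <= C * t ^+ 2.
  exact: (projT2 (choice (partial y))).
move: a' a'P => a' a'P.
pose a y : 'rV[R]_n.+1 := \row_i a' y i.
pose m : R := n.+1%:R; have m1 : 1 <= m by rewrite /m ler1n.
pose C' := C * m ^+ 2.
have C'0 : 0 <= C' by rewrite mulr_ge0// exprn_ge0//; lra.
have upper y h : `|y - y0| < r / 2 -> m * `|h| < r / 2 ->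
    f (y + h) - f y - dot (a y) h <= C' * `|h| ^+ 2.
  move=> yr hr.
  (* [y + h] is the mean of the points [z i], each displaced along a single axis, so Jensen's
     inequality reduces the bound to one variable. *)
  pose z (i : nat) := y + (m * h 0 (inord i)) *: delta_mx 0 (inord i).
  have mh i : `|m * h 0 i| <= m * `|h|.
    rewrite normrM ger0_norm; last lra.
    by rewrite ler_pM2l ?coord_le_norm//; lra.
  have mhr i : `|m * h 0 i| < r / 2 by apply: le_lt_trans hr.
  have Dz i : (i < n.+1)%N -> D (z i).
    move=> _; apply: near_D => //; rewrite rV_normZ (le_lt_trans _ (mhr (inord i)))//.
    by rewrite ler_piMr.
  have [_] := jensen_mean cvxD Dz.
  have -> : n.+1%:R^-1 *: \sum_(i < n.+1) z i = y + h.
    rewrite /z big_split /= sumr_const card_ord -[y *+ n.+1]scaler_nat scalerDr scalerA.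
    rewrite mulVf ?scale1r; last by rewrite pnatr_eq0.
    congr (_ + _); rewrite [RHS]row_sum_delta scaler_sumr; apply: eq_bigr => i _.
    by rewrite inord_val scalerA mulrA mulVf ?mul1r// pnatr_eq0.
  move=> h1.
  have h2 : n.+1%:R^-1 * \sum_(i < n.+1) f (z i) <=
     n.+1%:R^-1 * \sum_(i < n.+1) (f y + (m * (a y 0 i * h 0 i) + C' * `|h| ^+ 2)).
    rewrite ler_pM2l ?invr_gt0 ?ltr0n//; apply: ler_sum => i _.
    rewrite /z inord_val.
    have := a'P y i yr _ (mhr i).
    have : C * (m * h 0 i) ^+ 2 <= C' * `|h| ^+ 2.
      rewrite /C' -mulrA ler_wpM2l// -exprMn -(real_normK (num_real (m * _))).
      by rewrite ler_sqr ?nnegrE// mulr_ge0//; lra.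
    rewrite (_ : a y 0 i = a' y i); last by rewrite mxE.
    by lra.
  have h3 : n.+1%:R^-1 * \sum_(i < n.+1) (f y + (m * (a y 0 i * h 0 i) + C' * `|h| ^+ 2)) =
     f y + dot (a y) h + C' * `|h| ^+ 2.
    rewrite !big_split /= !sumr_const !card_ord -mulr_sumr -/(dot (a y) h).
    rewrite -[f y *+ _]mulr_natl -[(C' * _) *+ _]mulr_natl -/m.
    by rewrite -!mulrDr mulKf ?addrA// gt_eqF//; lra.
  by have := le_trans h1 h2; rewrite h3; lra.
have expansion y h : `|y - y0| < r / 2 -> m * `|h| < r / 2 ->
    `|f (y + h) - f y - dot (a y) h| <= C' * `|h| ^+ 2.
  (* Lower bound: midpoint convexity at [y], combined with the upper bound at [- h]. *)
  move=> yr hr; rewrite ler_norml upper// andbT.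
  have hN : m * `|- h| < r / 2 by rewrite normrN.
  have := upper y (- h) yr hN; rewrite dotN normrN.
  have hh : `|h| < r / 2.
    by apply: le_lt_trans hr; rewrite ler_peMl.
  have Dp := near_D _ _ yr hh; rewrite -normrN in hh; have Dm := near_D _ _ yr hh.
  have := (cvxD _ _ (1/2) (1/2) Dp Dm _ _ _).2.
  rewrite (_ : _ *: _ + _ = y); last by apply/rowP => i; rewrite !mxE; field.
  move=> h1; have {}h1 : f y <= 1/2 * f (y + h) + 1/2 * f (y - h) by apply: h1; lra.
  by lra.
have m0 : 0 < m by lra.
(* Points within [d / 2] of [y0] are at distance [t < d], and increments up to [2 * t] remain in the
   range of [expansion]. *)
pose d := r / (4 * m).
have d0 : 0 < d by rewrite divr_gt0// mulr_gt0.
have md : m * d = r / 4.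
  have cancel (p q : R) : p != 0 -> p * (q / (4 * p)) = q / 4 by move=> p0; field.
  by rewrite /d cancel// gt_eqF.
have dr : d <= r / 4 by rewrite -md ler_peMl//; lra.
exists (d / 2); first by lra.
have Df y : `|y - y0| < d / 2 ->
    differentiable (f : 'rV[R]_n.+1 -> R^o) y /\
    forall v, 'D_v (f : 'rV[R]_n.+1 -> R^o) y = dot (a y) v.
  move=> yd; apply: (differentiable_quadratic (f := f : 'rV[R]_n.+1 -> R^o)
    (L := dot (a y) : 'rV[R]_n.+1 -> R^o) (C := C') _ d0) => [|h hd].
    exact: dot_continuous.
  apply: expansion; first by lra.
  by have : m * `|h| < m * d by [rewrite ltr_pM2l]; lra.
split; first by move=> y /Df[].
move=> i y /= yd.
have oD : nbhs y [set z : 'rV[R]_n.+1 | `|z - y0| < d / 2].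
  have -> : [set z : 'rV[R]_n.+1 | `|z - y0| < d / 2] = ball y0 (d / 2).
    by apply/funext => z; rewrite -ball_normE /= distrC.
  by apply: open_nbhs_nbhs; split; [exact: ball_open|rewrite -ball_normE /= distrC].
exists [set z : 'rV[R]_n.+1 | `|z - y0| < d / 2] => //.
apply: (@klipschitzW _ _ _ (6 * C')).
  exact: (@globally_properfilter _ _ (y, y)).
move=> [u v] /= [ud vd].
rewrite (Df u ud).2 (Df v vd).2.
have dotE w : dot (a w) (delta_mx 0 i) = a w 0 i.
  rewrite /dot (bigD1 i)//= big1 ?addr0; first by rewrite [delta_mx _ _ _ _]mxE !eqxx mulr1.
  by move=> j ji; rewrite [delta_mx _ _ _ _]mxE eqxx /= (negbTE ji) mulr0.
rewrite !dotE.
have [->|uv] := eqVneq u v; first by rewrite !subrr !normr0 mulr0.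
pose k := u - v; pose t := `|k|.
have t0 : 0 < t by rewrite normr_gt0 subr_eq0.
have td : t < d.
  have := ler_normD (u - y0) (- (v - y0)); rewrite normrN.
  rewrite (_ : u - y0 + _ = k); first by rewrite -/t; lra.
  by apply/rowP => j; rewrite !mxE; ring.
(* Expanding at [u] along [h] and at [v] along [k + h] and [k] isolates [t * (a u 0 i - a v 0 i)],
   with remainders [1 + 4 + 1] times [C' * t ^+ 2]. *)
pose h : 'rV[R]_n.+1 := t *: delta_mx 0 i.
have ht : `|h| <= t by rewrite rV_normZ gtr0_norm// ler_piMr// ltW.
have mt : m * t < r / 4 by rewrite -md ltr_pM2l.
have hyp1 : m * `|h| < r / 2.
  by apply: (@le_lt_trans _ _ (m * t)); [rewrite ler_pM2l|lra].
have kh : `|k + h| <= 2 * t by have := ler_normD k h; rewrite -/t; lra.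
have hyp2 : m * `|k + h| < r / 2.
  by apply: (@le_lt_trans _ _ (m * (2 * t))); [rewrite ler_pM2l|lra].
have ur : `|u - y0| < r / 2 by lra.
have vr : `|v - y0| < r / 2 by lra.
have e1 := expansion u h ur hyp1.
have e2 := expansion v (k + h) vr hyp2.
have e3 := expansion v k vr (le_lt_trans (lexx _) (_ : m * `|k| < r / 2)).
have {}e3 : `|f (v + k) - f v - dot (a v) k| <= C' * `|k| ^+ 2 by apply: e3; rewrite -/t; lra.
have vk : v + k = u by rewrite /k subrKC.
rewrite addrA vk dotD in e2; rewrite vk in e3.
have dh w : dot (a w) h = t * a w 0 i by rewrite dotZ dotE.
rewrite !dh in e1 e2.
have b1 : C' * `|h| ^+ 2 <= C' * t ^+ 2 by rewrite ler_wpM2l// ler_sqr ?nnegrE// ltW.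
have b2 : C' * `|k + h| ^+ 2 <= C' * (2 * t) ^+ 2.
  by rewrite ler_wpM2l// ler_sqr ?nnegrE//; lra.
have b3 : C' * (2 * t) ^+ 2 = 4 * (C' * t ^+ 2) by ring.
have {}e1 := le_trans e1 b1; have {}e2 := le_trans e2 b2.
rewrite -/t in e3 *; rewrite b3 in e2.
have : `|t * (a u 0 i - a v 0 i)| <= t * (6 * C' * t).
  rewrite (_ : t * (6 * C' * t) = 6 * (C' * t ^+ 2)); last by ring.
  move: e1 e2 e3; rewrite !ler_norml; lra.
by rewrite normrM gtr0_norm// ler_pM2l.
Qed.

End differentiability.

(** * The boundary as a graph *)

Section frame.
Context {R : realType}.

Lemma mulmx_tr_dot n (a x : 'rV[R]_n) : x *m a^T = (dot a x)%:M.
Proof.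
apply/matrixP => i j; rewrite !ord1 !mxE eqxx mulr1n.
by apply: eq_bigr => k _; rewrite mxE mulrC.
Qed.

Lemma dotC n (a x : 'rV[R]_n) : dot a x = dot x a.
Proof. by apply: eq_bigr => i _; rewrite mulrC. Qed.

Lemma dot_ge0 n (a : 'rV[R]_n) : 0 <= dot a a.
Proof. by apply: sumr_ge0 => i _; rewrite -expr2 sqr_ge0. Qed.

Lemma dot_eq0 n (a : 'rV[R]_n) : dot a a = 0 -> a = 0.
Proof.
move=> /eqP; rewrite psumr_eq0 => [/allP h|i _]; last by rewrite -expr2 sqr_ge0.
apply/rowP => i; rewrite mxE; apply/eqP.
by have := h i (mem_index_enum i); rewrite /= mulf_eq0 orbb.
Qed.

Lemma householder_orthogonal n (u : 'rV[R]_n) : dot u u != 0 ->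
  let H := 1%:M - (2 / dot u u) *: (u^T *m u) in H *m H^T = 1%:M.
Proof.
move=> q0 /=; set H := _ - _.
have -> : H^T = H.
  apply/matrixP => i j; rewrite !mxE eq_sym; congr (_ - _ * _).
  by apply: eq_bigr => k _; rewrite !mxE mulrC.
rewrite /H.
rewrite mulmxBl mul1mx mulmxBr mulmx1 -!scalemxAl -!scalemxAr.
rewrite -mulmxA (mulmxA u) mulmx_tr_dot mul_scalar_mx -scalemxAr !scalerA.
by apply/matrixP => i j; rewrite !mxE; field.
Qed.

(* The Householder reflection exchanging [nu] and the first basis vector *)
Lemma orthogonal_completion n (nu : 'rV[R]_n.+1) : dot nu nu = 1 ->
  exists2 H : 'M[R]_n.+1, row ord0 H = nu & H *m H^T = 1%:M.
Proof.
move=> nu1; pose d0 : 'rV[R]_n.+1 := delta_mx 0 ord0.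
have dotd0 (a : 'rV[R]_n.+1) : dot a d0 = a 0 ord0.
  rewrite /dot (bigD1 ord0)//= big1 ?addr0; first by rewrite mxE !eqxx mulr1.
  by move=> j j0; rewrite mxE eqxx /= (negbTE j0) mulr0.
pose u := nu - d0; pose q := dot u u.
have [q0|q0] := eqVneq q 0.
  exists 1%:M; last by rewrite trmx1 mulmx1.
  by rewrite rowE mulmx1; apply/esym/eqP; rewrite -subr_eq0; apply/eqP/dot_eq0.
have qE : q = - 2 * u 0 ord0.
  have dotB (a : 'rV[R]_n.+1) : dot a u = dot a nu - a 0 ord0.
    by rewrite /u dotD dotN dotd0.
  have u0 : u 0 ord0 = nu 0 ord0 - 1 by rewrite !mxE eqxx.
  by rewrite /q dotB dotC dotB nu1 u0; ring.
exists (1%:M - (2 / q) *: (u^T *m u)).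
  rewrite rowE mulmxBr mulmx1 -scalemxAr mulmxA mulmx_tr_dot dotd0 mul_scalar_mx.
  rewrite scalerA (_ : 2 / q * _ = -1) ?scaleN1r ?opprK.
    by rewrite /u addrC subrK.
  rewrite qE; field; rewrite -[X in X != 0]opprK; apply/eqP => u0.
  by move/eqP: q0; apply; rewrite qE; lra.
exact: householder_orthogonal.
Qed.

(** Take an orthogonal matrix with first row [nu]; the reconstruction formula is [H^T *m H = 1] with
    that row split off. *)
Lemma exists_frame n (e : 'rV[R]_n.+1) : e != 0 ->
  exists (B : 'M[R]_(n, n.+1)) (nu : 'rV[R]_n.+1) (c : R),
   [/\ 0 < c, nu = c *: e, orthonormal_frame (N := n.+1) B nu &
     forall x : 'rV[R]_n.+1, (x *m B^T) *m B + dot nu x *: nu = x].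
Proof.
move=> e0; have de0 : 0 < dot e e.
  rewrite lt_neqAle dot_ge0 andbT eq_sym; apply: contra e0 => /eqP/dot_eq0 ->.
  by rewrite eqxx.
pose c := (Num.sqrt (dot e e))^-1.
have c0 : 0 < c by rewrite invr_gt0 sqrtr_gt0.
have [nu nu_ce nu1] : exists2 nu : 'rV[R]_n.+1, nu = c *: e & dot nu nu = 1.
  exists (c *: e) => //; rewrite dotZ dotC dotZ mulrA -expr2 /c exprVn sqr_sqrtr ?mulVf ?gt_eqF//.
  exact: ltW.
have [H Hnu HH] := orthogonal_completion nu1.
have H'H : H^T *m H = 1%:M by exact: mulmx1C.
have nuE j : nu 0 j = H ord0 j by rewrite -Hnu mxE.
exists (row' ord0 H), nu, c; split => //.
  split.
  - apply/matrixP => i j; move/matrixP/(_ (lift ord0 i) (lift ord0 j)): HH.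
    rewrite !mxE (inj_eq lift_inj) => <-.
    by apply: eq_bigr => k _; rewrite !mxE.
  - apply/matrixP => i j; move/matrixP/(_ (lift ord0 i) ord0): HH.
    rewrite !ord1 !mxE => h; rewrite -[RHS]h.
    by apply: eq_bigr => k _; rewrite !mxE nuE.
  - by rewrite mulmx_tr_dot nu1.
move=> x; rewrite -[RHS]mulmx1 -H'H.
have -> : dot nu x *: nu = (x *m nu^T) *m nu by rewrite mulmx_tr_dot mul_scalar_mx.
rewrite -!mulmxA -mulmxDr; congr (x *m _).
apply/matrixP => i j; rewrite !mxE [RHS]big_ord_recl [X in _ + X]big_ord1 addrC; congr (_ + _).
  by rewrite !mxE !nuE.
by apply: eq_bigr => k _; rewrite !mxE.
Qed.

Lemma mulmx_bound m n (A : 'M[R]_(m, n)) :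
  exists2 C : R, 0 <= C & forall x : 'rV[R]_m, `|x *m A| <= C * `|x|.
Proof.
exists (\sum_i \sum_j `|A i j|).
  by apply: sumr_ge0 => i _; apply: sumr_ge0 => j _.
move=> x; apply/rV_norm_leP => [|j].
  by apply: mulr_ge0 => //; apply: sumr_ge0 => i _; apply: sumr_ge0.
rewrite mxE (le_trans (ler_norm_sum _ _ _))// mulr_suml ler_sum// => i _.
rewrite normrM mulrC ler_pM// ?coord_le_norm//.
by rewrite (bigD1 j)//= lerDl; apply: sumr_ge0.
Qed.

End frame.

Section local_graph.
Context {R : realType}.

Lemma open_norm n (A : set 'rV[R]_n) :
  (forall x, A x -> exists2 d : R, 0 < d & forall x', `|x' - x| < d -> A x') -> open A.
Proof.
move=> h; rewrite openE => x /h[d d0 dA].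
by apply/interior_ball_sub; exists d.
Qed.

Lemma frame_coordinates n (B : 'M[R]_(n, n.+1)) (nu : 'rV[R]_n.+1) y t :
  orthonormal_frame (N := n.+1) B nu ->
  (y *m B + t *: nu) *m B^T = y /\ dot nu (y *m B + t *: nu) = t.
Proof.
move=> [BB Bnu nunu]; split.
  rewrite mulmxDl -mulmxA BB mulmx1 -scalemxAl -[nu *m B^T]trmxK trmx_mul trmxK.
  by rewrite Bnu trmx0 scaler0 addr0.
rewrite dotD dotZ.
have -> : dot nu (y *m B) = 0.
  have /matrixP/(_ 0 0) := mulmx_tr_dot nu (y *m B).
  by rewrite -mulmxA Bnu mulmx0 !mxE eqxx mulr1n.
have -> : dot nu nu = 1.
  have /matrixP/(_ 0 0) := mulmx_tr_dot nu nu.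
  by rewrite nunu !mxE eqxx !mulr1n.
by rewrite add0r mulr1.
Qed.

(* [f y] is the first parameter at which the line [y *m B + t *: nu] enters G *)
Lemma convex_local_graph n (G : set 'rV[R]_n.+1) (B : 'M[R]_(n, n.+1))
    (nu p : 'rV[R]_n.+1) (MG l rho : R) :
  closed G -> segment_closed G -> bounded_by MG G ->
  orthonormal_frame (N := n.+1) B nu ->
  (forall x, (x *m B^T) *m B + dot nu x *: nu = x) ->
  0 < l -> 0 < rho -> ball_sub G (p + l *: nu) rho ->
  exists (f : 'rV[R]_n -> R) (r M : R), [/\ 0 < r,
    forall y, `|y - p *m B^T| < r ->
      [/\ boundary G (y *m B + f y *: nu), f y < dot nu p + l & `|f y| <= M],
    forall y t, `|y - p *m B^T| < r -> t < dot nu p + l ->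
      boundary G (y *m B + t *: nu) -> t = f y &
    forall x y a b, `|x - p *m B^T| < r -> `|y - p *m B^T| < r ->
      0 <= a -> 0 <= b -> a + b = 1 -> f (a *: x + b *: y) <= a * f x + b * f y].
Proof.
move=> cG segG MGG frame dec l0 rho0 pG.
pose P y t := y *m B + t *: nu; pose t0 := dot nu p + l; pose yp := p *m B^T.
have [CB CB0 CBP] := mulmx_bound B.
have [Cn Cn0 CnP] := mulmx_bound nu^T.
have dotP x : `|dot nu x| <= Cn * `|x|.
  by apply: le_trans (CnP x); rewrite mulmx_tr_dot; have := coord_le_norm (dot nu x)%:M 0;
    rewrite mxE eqxx mulr1n.
(* For [|y - yp| < r] the point at height [t0] over [y] moves by at most [rho / 2], so it keeps a
   ball of radius [rho / 2] in [G]. *)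
pose r := rho / (2 * (CB + 1)).
have r0 : 0 < r by rewrite divr_gt0// mulr_gt0//; lra.
have rCB : CB * r <= rho / 2.
  have : r * (CB + 1) = rho / 2 by rewrite /r; field; lra.
  by rewrite mulrDr mulr1; lra.
pose E y := [set t | G (P y t)].
have Pt0 : P yp t0 = p + l *: nu.
  by rewrite /P /yp /t0 scalerDl addrA dec.
have ballP y : `|y - yp| < r -> ball_sub G (P y t0) (rho / 2).
  move=> yr w wP; apply: pG; rewrite -Pt0.
  have := ler_normD (w - P y t0) ((y - yp) *m B).
  rewrite (_ : w - P y t0 + _ = w - P yp t0); last first.
    by rewrite /P mulmxBl; apply/rowP => i; rewrite !mxE; ring.
  have := CBP (y - yp).
  have : CB * `|y - yp| <= CB * r by apply: ler_wpM2l => //; exact: ltW.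
  by lra.
have Et0 y : `|y - yp| < r -> E y t0.
  by move=> /ballP; apply; rewrite subrr normr0; lra.
have Ebound y t : E y t -> `|t| <= Cn * MG.
  move=> Gt; have [_ <-] := frame_coordinates y t frame.
  by apply: le_trans (dotP _) _; apply: ler_wpM2l => //; exact: MGG.
have Einf y : `|y - yp| < r -> has_inf (E y).
  move=> yr; split; first by exists t0; exact: Et0.
  by exists (- (Cn * MG)) => t /Ebound; rewrite ler_norml; lra.
pose f y := inf (E y).
have normnu s t y : `|P y t - P y s| = `|t - s| * `|nu|.
  by rewrite -rV_normZ; congr `|_|; apply/rowP => i; rewrite !mxE; ring.
have nu1 : 0 < `|nu| + 1 by rewrite ltr_wpDl.
have fE y : `|y - yp| < r -> G (P y (f y)).
  move=> yr; apply: (closedP _).1 => // e e0.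
  have [t Et tf] := inf_adherent (divr_gt0 e0 nu1) (Einf y yr).
  have ft : f y <= t by apply: ge_inf => //; exact: (Einf y yr).2.
  exists (P y t) => //; rewrite normnu ger0_norm; last by rewrite /f in ft *; lra.
  have : t - f y < e / (`|nu| + 1) by rewrite /f in ft *; lra.
  rewrite ltr_pdivlMr//; apply: le_lt_trans.
  by apply: ler_wpM2l; [rewrite subr_ge0|rewrite lerDl].
have f_lt y t : `|y - yp| < r -> t < f y -> ~ G (P y t).
  move=> yr tf Gt; have : f y <= t by apply: ge_inf => //; exact: (Einf y yr).2.
  by lra.
have ft0 y : `|y - yp| < r -> f y < t0.
  move=> yr; pose s := t0 - rho / (2 * (`|nu| + 1)).
  have d0 : 0 < rho / (2 * (`|nu| + 1)) by rewrite divr_gt0// mulr_gt0.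
  apply: (@le_lt_trans _ _ s); last by rewrite /s; lra.
  apply: ge_inf; first exact: (Einf y yr).2.
  apply: (ballP y yr); rewrite normnu /s.
  rewrite (_ : t0 - _ - t0 = - (rho / (2 * (`|nu| + 1)))); last by ring.
  rewrite normrN gtr0_norm// mulrAC ltr_pdivrMr ?mulr_gt0//.
  rewrite (_ : rho / 2 * _ = rho * (`|nu| + 1)); last by field.
  by rewrite ltr_pM2l// ltrDl.
have fb y : `|y - yp| < r -> boundary G (P y (f y)).
  move=> yr; apply/closed_boundary => //; split; first exact: fE.
  move=> /interior_ball_sub[e e0 eG].
  have d0 : 0 < e / (2 * (`|nu| + 1)) by rewrite divr_gt0// mulr_gt0.
  apply: (f_lt y (f y - e / (2 * (`|nu| + 1)))) => //; first by lra.
  apply: eG; rewrite normnu.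
  rewrite (_ : f y - _ - f y = - (e / (2 * (`|nu| + 1)))); last by ring.
  rewrite normrN gtr0_norm// mulrAC ltr_pdivrMr ?mulr_gt0//.
  by rewrite ltr_pM2l//; lra.
exists f, r, (Cn * MG); split => //.
- move=> y yr; split; [exact: fb|exact: ft0|].
  by apply: (Ebound y); exact: fE.
- move=> y t yr tt0 /(closed_boundary _ cG)[Gt nGt].
  have [ft|tf|//] := ltgtP t (f y); first by have := f_lt y t yr ft.
  exfalso; apply: nGt; rewrite -/t0 in tt0.
  have tf0 : 0 < t0 - f y by lra.
  have rh : 0 < rho / 2 by lra.
  (* Points strictly between the entry point and height [t0] are interior: they lie in the cone from
     the entry point over the ball. *)
  have := segment_closed_ball_sub (a := (t - f y) / (t0 - f y))
    (b := (t0 - t) / (t0 - f y)) segG (ballP y yr) (fE y yr).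
  rewrite (_ : _ *: P y t0 + _ = P y t); last first.
    by apply/rowP => i; rewrite !mxE; field; lra.
  have s0 : 0 < (t - f y) / (t0 - f y) by apply: divr_gt0; lra.
  move=> h; apply: (ball_sub_interior (mulr_gt0 s0 rh)); apply: h => //.
    by apply: divr_ge0; lra.
  by field; lra.
- move=> x y a b xr yr a0 b0 ab.
  have xyr := segment_closed_norm_lt xr yr a0 b0 ab.
  apply: ge_inf; first exact: (Einf _ xyr).2.
  rewrite /E /= (_ : P _ _ = a *: P x (f x) + b *: P y (f y)).
    by apply: segG => //; exact: fE.
  rewrite /P mulmxDl -!scalemxAl; apply/rowP => i; rewrite !mxE; ring.
Qed.

(** For close points, prolong the segment from [y] through [x] to [z] at distance [r / 4] from [y];
    convexity bounds the slope by the oscillation [2 * M] over that length. *)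
Lemma convex_bounded_lipschitz n (f : 'rV[R]_n -> R) (y0 : 'rV[R]_n) (r M : R) :
  0 < r -> (forall y, `|y - y0| < r -> `|f y| <= M) ->
  (forall x y a b, `|x - y0| < r -> `|y - y0| < r -> 0 <= a -> 0 <= b -> a + b = 1 ->
    f (a *: x + b *: y) <= a * f x + b * f y) ->
  exists2 L : R, 0 <= L & forall x y, `|x - y0| < r / 2 -> `|y - y0| < r / 2 ->
    `|f x - f y| <= L * `|x - y|.
Proof.
move=> r0 fM cvx.
have M0 : 0 <= M by apply: le_trans (fM y0 _) => //; rewrite subrr normr0.
exists (8 * M / r); first by apply: divr_ge0; lra.
have one_sided x y : `|x - y0| < r / 2 -> `|y - y0| < r / 2 ->
    f x - f y <= 8 * M / r * `|x - y|.
  move=> xr yr.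
  have fMx : `|f x| <= M by apply: fM; lra.
  have fMy : `|f y| <= M by apply: fM; lra.
  have [->|xy] := eqVneq x y; first by rewrite !subrr normr0 mulr0.
  have k0 : 0 < `|x - y| by rewrite normr_gt0 subr_eq0.
  have [far|near] := leP (r / 4) `|x - y|.
    have : 8 * M / r * (r / 4) <= 8 * M / r * `|x - y|.
      by apply: ler_wpM2l => //; apply: divr_ge0; lra.
    rewrite (_ : 8 * M / r * (r / 4) = 2 * M); last by field; lra.
    by move: fMx fMy; rewrite !ler_norml; lra.
  pose la := 4 * `|x - y| / r.
  have la0 : 0 < la by rewrite divr_gt0// mulr_gt0.
  have la1 : la < 1 by rewrite ltr_pdivrMr//; lra.
  pose z := y + la^-1 *: (x - y).
  have zr : `|z - y0| < r.
    have := ler_normD (la^-1 *: (x - y)) (y - y0).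
    rewrite (_ : la^-1 *: (x - y) + _ = z - y0); last first.
      by apply/rowP => i; rewrite !mxE; ring.
    rewrite rV_normZ gtr0_norm ?invr_gt0// /la invf_div mulrAC.
    rewrite (_ : r * `|x - y| / (4 * `|x - y|) = r / 4); first by lra.
    by field; rewrite gt_eqF.
  have yr' : `|y - y0| < r by lra.
  have := cvx z y la (1 - la) zr yr'.
  rewrite (_ : _ *: _ + _ = x); last first.
    by apply/rowP => i; rewrite !mxE; field; rewrite gt_eqF.
  move=> h; have {}h : f x <= la * f z + (1 - la) * f y by apply: h; lra.
  have fMz := fM z zr.
  have : la * (f z - f y) <= la * (2 * M).
    by rewrite ler_pM2l//; move: fMz fMy; rewrite !ler_norml; lra.
  rewrite (_ : la * (2 * M) = 8 * M / r * `|x - y|); first by lra.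
  by rewrite /la; field; lra.
move=> x y xr yr; rewrite ler_norml one_sided// andbT.
by have := one_sided y x yr xr; rewrite distrC; lra.
Qed.

End local_graph.

(** * From boundary points to a [C^{1,1}] graph *)

Section conclusion.
Context {R : realType}.

Lemma compact_bounded_by n (A : set 'rV[R]_n) : compact A ->
  exists2 M : R, 0 < M & bounded_by M A.
Proof.
move=> /compact_bounded [M [_ MA]]; exists (`|M| + 1); first by rewrite ltr_wpDl.
by move=> x Ax; apply: MA Ax; rewrite (le_lt_trans (ler_norm M))// ltrDl.
Qed.

(* A second difference [2 * s] of the graph function comes from three boundary *)
(* points [x], [x + s *: nu + v], [x + s *: nu - v].                          *)
Lemma graph_semiconcave n (G : set 'rV[R]_n.+1) (B : 'M[R]_(n, n.+1))
    (nu p : 'rV[R]_n.+1) (f : 'rV[R]_n -> R) (r L eta C : R) :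
  0 < r -> 0 <= L -> 0 < eta -> 0 <= C ->
  p = (p *m B^T) *m B + f (p *m B^T) *: nu ->
  (forall y, `|y - p *m B^T| < r -> boundary G (y *m B + f y *: nu)) ->
  (forall x y a b, `|x - p *m B^T| < r -> `|y - p *m B^T| < r ->
      0 <= a -> 0 <= b -> a + b = 1 -> f (a *: x + b *: y) <= a * f x + b * f y) ->
  (forall x y, `|x - p *m B^T| < r -> `|y - p *m B^T| < r ->
    `|f x - f y| <= L * `|x - y|) ->
  (forall x v (s : R), `|x - p| < eta -> boundary G x -> 0 <= s -> s <= eta ->
    `|v| <= eta -> boundary G (x + s *: nu + v) -> boundary G (x + s *: nu - v) ->
    s <= C * `|v| ^+ 2) ->
  exists2 r' : R, 0 < r' <= r & exists2 C' : R, 0 <= C' &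
    forall y h, `|y - p *m B^T| < r' -> `|y + h - p *m B^T| < r' ->
      `|y - h - p *m B^T| < r' -> f (y + h) + f (y - h) - 2 * f y <= C' * `|h| ^+ 2.
Proof.
move=> r0 L0 eta0 C0; set yp := p *m B^T => pE fb cvx lip sd.
have [CB CB0 CBP] := mulmx_bound B.
(* [Q] times the length of the increment dominates [v], [s] and [x - p] together. *)
pose Q := CB + L * `|nu| + L + 1.
have Lnu0 : 0 <= L * `|nu| by rewrite mulr_ge0.
have Q0 : 0 < Q by rewrite /Q; lra.
pose r1 := eta / (2 * Q); have r10 : 0 < r1 by rewrite divr_gt0// mulr_gt0.
have minP (x y : R) : Num.min x y <= x /\ Num.min x y <= y.
  by rewrite !ge_min !lexx orbT.
have [r'r r'r1] := minP r r1; set r' := Num.min r r1 in r'r r'r1.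
have r'0 : 0 < r' by rewrite lt_min r0.
exists r'; first by rewrite r'0.
have C'0 : 0 <= 2 * C * Q ^+ 2 by rewrite !mulr_ge0// ?exprn_ge0// ltW.
exists (2 * C * Q ^+ 2) => // y h yr yhr ymr.
have yr' : `|y - yp| < r by lra.
have yhr' : `|y + h - yp| < r by lra.
have ymr' : `|y - h - yp| < r by lra.
have h2r : `|h| < 2 * r'.
  have := ler_normD (y + h - yp) (- (y - yp)); rewrite normrN.
  rewrite (_ : y + h - yp + _ = h); first by lra.
  by apply/rowP => i; rewrite !mxE; ring.
have Qr t : 0 <= t -> t < 2 * r' -> Q * t <= eta.
  move=> t_ge0 t2.
  have : Q * t <= Q * (2 * r1) by rewrite ler_pM2l//; lra.
  have Qn0 : Q != 0 by rewrite gt_eqF.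
  have cancel (q e : R) : q != 0 -> q * (2 * (e / (2 * q))) = e by move=> q0; field.
  by rewrite /r1 cancel.
have CB_le t : 0 <= t -> CB * t + L * `|nu| * t <= Q * t.
  by move=> t_ge0; rewrite /Q; have := mulr_ge0 L0 t_ge0; lra.
pose x := y *m B + f y *: nu.
pose s := (f (y + h) + f (y - h)) / 2 - f y.
(* With this tilt [D], [x + s *: nu + v] and [x + s *: nu - v] are the graph points over [y + h] and
   [y - h]. *)
pose D := (f (y + h) - f (y - h)) / 2.
pose v := h *m B + D *: nu.
have s0 : 0 <= s.
  have := cvx _ _ (1/2) (1/2) yhr' ymr'.
  rewrite (_ : _ *: _ + _ = y); last by apply/rowP => i; rewrite !mxE; field.
  by move=> hc; have {hc} := hc _ _ _; rewrite /s; lra.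
have l1 := lip _ _ yhr' yr'; have l2 := lip _ _ ymr' yr'.
rewrite [y + h]addrC addrK in l1; rewrite [y - h]addrC addrK normrN in l2.
have sL : s <= L * `|h|.
  by move: l1 l2; rewrite [h + y]addrC [- h + y]addrC !ler_norml /s; lra.
have DL : `|D| <= L * `|h|.
  by move: l1 l2; rewrite [h + y]addrC [- h + y]addrC !ler_norml /D; lra.
have vQ : `|v| <= Q * `|h|.
  apply: le_trans (CB_le _ (normr_ge0 h)); apply: le_trans (ler_normD _ _) _.
  rewrite rV_normZ lerD//; rewrite mulrAC ler_wpM2r//.
have hQ : Q * `|h| <= eta by exact: Qr.
have Lh : L * `|h| <= Q * `|h|.
  by apply: ler_wpM2r => //; rewrite /Q; lra.
have xp : `|x - p| < eta.
  rewrite pE (_ : x - _ = (y - yp) *m B + (f y - f yp) *: nu); last first.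
    by rewrite /x -/yp mulmxBl; apply/rowP => i; rewrite !mxE; ring.
  have yy : `|yp - yp| < r by rewrite subrr normr0.
  have l3 := lip _ _ yr' yy.
  have b1 : `|f y - f yp| * `|nu| <= L * `|nu| * `|y - yp|.
    by rewrite mulrAC ler_wpM2r.
  have b2 := CBP (y - yp).
  have := ler_normD ((y - yp) *m B) ((f y - f yp) *: nu); rewrite rV_normZ.
  have := CB_le _ (normr_ge0 (y - yp)).
  have : Q * `|y - yp| < eta.
    have [->|yneq] := eqVneq y yp; first by rewrite subrr normr0 mulr0.
    have : 0 < Q * `|y - yp| by rewrite mulr_gt0// normr_gt0 subr_eq0.
    have : Q * (2 * `|y - yp|) <= eta by apply: Qr; [rewrite mulr_ge0|rewrite ltr_pM2l].
    by lra.
  by lra.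
have bp : boundary G (x + s *: nu + v).
  rewrite (_ : _ + v = (y + h) *m B + f (y + h) *: nu); first exact: fb.
  by rewrite /x /v /s /D mulmxDl; apply/rowP => i; rewrite !mxE; field.
have bm : boundary G (x + s *: nu - v).
  rewrite (_ : _ - v = (y - h) *m B + f (y - h) *: nu); first exact: fb.
  by rewrite /x /v /s /D mulmxBl; apply/rowP => i; rewrite !mxE; field.
have seta : s <= eta by lra.
have veta : `|v| <= eta by lra.
have := sd x v s xp (fb _ yr') s0 seta veta bp bm.
have : C * `|v| ^+ 2 <= C * (Q * `|h|) ^+ 2.
  by apply: ler_wpM2l => //; rewrite ler_sqr ?nnegrE// mulr_ge0// ltW.
rewrite exprMn (_ : f (y + h) + f (y - h) - 2 * f y = 2 * s); last by rewrite /s; field.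
by lra.
Qed.

(** The direction [nu] points from [p] to an interior point [z], so lines parallel to it near [p]
    run into a ball inside [G]. *)
Lemma locally_C11_boundary n (K G : set 'rV[R]_n.+2) (a : R -> R) (CK eK MG : R) :
  closed K -> segment_closed K -> bounded_by CK K -> 0 < CK ->
  0 < eK -> ball_sub K 0 eK ->
  closed G -> segment_closed G -> bounded_by MG G -> G° !=set0 ->
  (forall x (r : R), boundary G x -> 0 < r -> vol (G `&` translate_scale x r K) = a r) ->
  locally_C11_graph (boundary G).
Proof.
move=> cK segK CKK CK0 eK0 ballK cG segG MGG [z Gz] volG p bp.
have [Gp nGp] := (closed_boundary _ cG).1 bp.
have zp : z - p != 0.
  by rewrite subr_eq0; apply/eqP => zp; apply: nGp; rewrite -zp.
have [B [nu [c [c0 nuE frame dec]]]] := exists_frame zp.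
have /interior_ball_sub[rho rho0 zG] := Gz.
pose l := c^-1; have l0 : 0 < l by rewrite invr_gt0.
have pG : ball_sub G (p + l *: nu) rho.
  by rewrite nuE scalerA mulVf ?gt_eqF// scale1r addrC subrK.
have [f [r [M [r0 fP funi cvx]]]] :=
  convex_local_graph cG segG MGG frame dec l0 rho0 pG.
set yp := p *m B^T in fP funi cvx *; set t0 := dot nu p + l in fP funi *.
have ypr : `|yp - yp| < r by rewrite subrr normr0.
have tp : dot nu p = f yp.
  by apply: funi => //; rewrite /t0 ?ltrDl// /yp dec.
have pE : p = yp *m B + f yp *: nu by rewrite -tp /yp dec.
have [eta eta0 [C C0 sd]] := boundary_second_difference cK segK CKK CK0 eK0 ballK
  cG segG MGG volG l0 rho0 pG.
have fM y : `|y - yp| < r -> `|f y| <= M by move=> /fP[].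
have [L L0 lip] := convex_bounded_lipschitz r0 fM cvx.
have r20 : 0 < r / 2 by lra.
have [||r' /andP[r'0 r'r] [C' C'0 sc]] :=
  graph_semiconcave r20 L0 eta0 C0 pE _ _ lip sd.
- by move=> y yr; have [|//] := fP y; lra.
- by move=> x y b d xr yr; apply: cvx; lra.
have [|d d0 fC11] := C11_convex_semiconcave r'0 C'0 _ sc.
  by move=> x y b e xr yr; apply: cvx; lra.
pose d' := Num.min d r.
have d'0 : 0 < d' by rewrite lt_min d0.
have [d'd d'r] : d' <= d /\ d' <= r by rewrite !ge_min !lexx orbT.
pose W : set 'rV[R]_n.+1 := [set y | `|y - yp| < d'].
have [CB CB0 CBP] := mulmx_bound B^T.
have [Cn Cn0 CnP] := mulmx_bound nu^T.
have dotP (x : 'rV[R]_n.+2) : `|dot nu x| <= Cn * `|x|.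
  apply: le_trans (CnP x); rewrite mulmx_tr_dot.
  by have := coord_le_norm (dot nu x)%:M 0; rewrite mxE eqxx mulr1n.
(* The bound [t0] on the height excludes the far side of [G]; below it [funi] leaves only the
   graph. *)
pose U : set 'rV[R]_n.+2 := [set x | W (x *m B^T) /\ dot nu x < t0].
exists B, nu, U, W, f; split => //.
- split; last first.
    split; first by rewrite /W /= subrr normr0.
    by rewrite /t0 ltrDl.
  apply: open_norm => x [xW xt].
  pose e1 := d' - `|x *m B^T - yp|; pose e2 := t0 - dot nu x.
  have e10 : 0 < e1 by rewrite /e1 subr_gt0.
  have e20 : 0 < e2 by rewrite /e2 subr_gt0.
  have CB1 : 0 < CB + 1 by lra.
  have Cn1 : 0 < Cn + 1 by lra.
  exists (Num.min (e1 / (CB + 1)) (e2 / (Cn + 1))); first by rewrite lt_min !divr_gt0.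
  move=> x'; rewrite lt_min !ltr_pdivlMr// => /andP[h1 h2].
  have xx0 := normr_ge0 (x' - x).
  split.
    rewrite /W /=; have := ler_normD ((x' - x) *m B^T) (x *m B^T - yp).
    rewrite mulmxBl addrA subrK -mulmxBl; have := CBP (x' - x).
    by rewrite /e1 in h1; lra.
  have := dotP (x' - x); rewrite dotD dotN => h3.
  have := le_trans (ler_norm _) h3.
  by rewrite /e2 in h2; lra.
- apply: open_norm => y yW; exists (d' - `|y - yp|); first by rewrite subr_gt0.
  move=> y' yy; have := ler_normD (y' - y) (y - yp).
  by rewrite addrA subrK /W /=; lra.
- have [fd fl] := fC11; split => [y yW|i y yW]; first by apply: fd; apply: lt_le_trans d'd.
  by apply: fl; apply: lt_le_trans d'd.
- apply/seteqP; split.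
    move=> x [bx [xW xt]]; exists (x *m B^T) => //.
    rewrite -(funi (x *m B^T) (dot nu x)) ?dec//.
    by apply: lt_le_trans d'r.
  move=> _ [y yW <-]; have yr : `|y - yp| < r by apply: lt_le_trans d'r.
  have [by1 ft _] := fP y yr; have [e1 e2] := frame_coordinates y (f y) frame.
  by split => //; rewrite /U /= e1 e2.
Qed.

End conclusion.

Theorem theorem2p5 (R : realType) (N : nat) (hN : (2 <= N)%N)
    (K G : set 'rV[R]_N) (hK : convex_body K) (hK0 : K° 0)
    (hG : K_dense_body K G) :
  locally_C11_graph (boundary G).
Proof.
case: N hN K G hK hK0 hG => [|[|n]] // _ K G [[coK _] /convex_segment_closed segK].
move=> /interior_ball_sub[eK eK0 ballK] [[coG Gi] [_ _ [c [c0 cG]]]].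
have clK : closed K by apply: compact_closed => //; exact: norm_hausdorff.
have clG : closed G by apply: compact_closed => //; exact: norm_hausdorff.
have [CK CK0 CKK] := compact_bounded_by coK.
have [MG MG0 MGG] := compact_bounded_by coG.
(* The density condition with its denominator cleared, legitimate as [r K] has positive volume. *)
pose a r := c r * vol (translate_scale 0 r K).
have den_gt0 r : 0 < r -> 0 < vol (translate_scale 0 r K).
  move=> r0; apply: (@vol_gt0 _ _ _ 0).
    split; first by apply: borel_closed; exact: closed_translate_scale.
    exists (r * CK) => _ [k /CKK kC <-]; rewrite add0r rV_normZ gtr0_norm//.
    by rewrite ler_pM2l.
  apply/interior_ball_sub; exists (r * eK); first by rewrite mulr_gt0.
  move=> w wr; apply/translate_scaleE => //; apply: ballK; rewrite subr0 in wr.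
  by rewrite !subr0 rV_normZ gtr0_norm ?invr_gt0// mulrC ltr_pdivrMr// mulrC.
have volG x r : boundary G x -> 0 < r -> vol (G `&` translate_scale x r K) = a r.
  move=> bx r0; rewrite /a -(cG x r bx r0) /density /vol divfK//.
  by rewrite gt_eqF// den_gt0.
have a_gt0 r : 0 < r -> 0 < a r by move=> r0; rewrite mulr_gt0 ?c0 ?den_gt0.
have segG := segment_closed_body (ltn0Sn _) clK segK CKK CK0 eK0 ballK clG MGG Gi
  volG a_gt0.
exact: (locally_C11_boundary clK segK CKK CK0 eK0 ballK clG segG MGG Gi volG).
Qed.
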